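(* Let $X,Y$ be real Banach spaces, let $T:X\rightrightarrows X^*$ be a maximal monotone operator of type (D) and let $A:Y\to X$ be a linear continuous map. Then the variational composition $(A^*TA)_v$ is representable.
   Context: Operators are identified with their graphs. For a maximal monotone $T:X\rightrightarrows X^*$, $\widetilde T=\{(x^{**},x^* )\in X^{**}\times X^*: \langle x^{**}-y, x^*-y^*\rangle\ge 0 \text{ for all }(y,y^* )\in T\}$. $T$ is of type (D) if every $(x^{**},x^* )\in\widetilde T$ is the weak$^*\times$strong limit of a bounded net in $T$. A monotone operator $S:Y\rightrightarrows Y^*$ is representable if there is a convex, proper, lower semicontinuous $h:Y\times Y^*\to\mathbb{R}\cup\{+\infty\}$ with $h(y,y^* )\ge\langle y,y^*\rangle$ for all $(y,y^* )$ and $S=\{(y,y^* ): h(y,y^* )=\langle y,y^*\rangle\}$. With $J=\partial\frac12\|\cdot\|^2$, for $T$ of type (D) and $\lambda>0$ the Moreau-Yosida regularization is $T_\lambda=\{(x,x^* ): \exists\, z^{**}\in X^{**} \text{ with } x^*\in\widetilde T(z^{**}),\ 0\in\lambda x^*+\widetilde J(z^{**}-x)\}$. The sequential lower limit of operators $S_n:Y\rightrightarrows Y^*$ is $\liminf S_n=\{(y,y^* ): \exists\,(y_n,y_n^* )\in S_n \text{ with } (y_n,y_n^* )\to(y,y^* ) \text{ in the strong}\times\text{strong topology}\}$. Let $\mathcal{J}=\{(\lambda_n)_n\subset\mathbb{R}: \lambda_n>0,\ \lambda_n\to 0^+\}$. The variational composition is $(A^*TA)_v=\bigcap_{\mathcal{J}}\liminf_n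 A^*T_{\lambda_n}A$. *)

(* Defs.v *)
From mathcomp Require Import all_boot all_order all_algebra.
From mathcomp Require Import all_classical all_reals all_analysis.
Set Implicit Arguments. Unset Strict Implicit. Unset Printing Implicit Defensive.
Import Order.TTheory GRing.Theory Num.Theory.
Import numFieldNormedType.Exports.
Local Open Scope classical_set_scope.
Local Open Scope ring_scope.

Section Defs.
Variable R : realType.

Definition is_dual (X : normedModType R) (f : X -> R) : Prop :=
  (forall x y : X, f (x + y) = f x + f y) /\
  (forall (a : R) (x : X), f (a *: x) = a * f x) /\
  continuous f.

Definition dnorm (X : normedModType R) (f : X -> R) : R :=
  sup [set `|f x| | x in [set x : X | `|x| <= 1]].

Definition is_bidual (X : normedModType R) (phi : (X -> R) -> R) : Prop :=
  (forall f g, is_dual f -> is_dual g ->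
     phi (fun x => f x + g x) = phi f + phi g) /\
  (forall (a : R) f, is_dual f -> phi (fun x => a * f x) = a * phi f) /\
  (exists C : R, forall f, is_dual f -> `|phi f| <= C * dnorm f).

Definition jX (X : normedModType R) (x : X) : (X -> R) -> R := fun f => f x.

Definition op (X : normedModType R) := set (X * (X -> R)).

Definition in_graph_space (X : normedModType R) (T : op X) : Prop :=
  forall p, T p -> is_dual p.2.

Definition monotone_op (X : normedModType R) (T : op X) : Prop :=
  forall p q, T p -> T q -> 0 <= p.2 (p.1 - q.1) - q.2 (p.1 - q.1).

Definition maximal_monotone (X : normedModType R) (T : op X) : Prop :=
  in_graph_space T /\ monotone_op T /\
  forall S : op X, in_graph_space S -> monotone_op S -> T `<=` S -> S = T.

Definition Ttilde (X : normedModType R) (T : op X) :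
    set (((X -> R) -> R) * (X -> R)) :=
  [set p | is_bidual p.1 /\ is_dual p.2 /\
     forall q, T q ->
       0 <= p.1 (fun x => p.2 x - q.2 x) - (p.2 q.1 - q.2 q.1)].

Definition typeD (X : normedModType R) (T : op X) : Prop :=
  forall p, Ttilde T p ->
    exists (I : Type) (le : I -> I -> Prop) (u : I -> X * (X -> R)),
      inhabited I /\
      (forall i, le i i) /\
      (forall i j k, le i j -> le j k -> le i k) /\
      (forall i j, exists k, le i k /\ le j k) /\
      (forall i, T (u i)) /\
      (exists M : R, forall i, `|(u i).1| <= M /\ dnorm (u i).2 <= M) /\
      (forall f, is_dual f -> forall e : R, 0 < e ->
         exists i0, forall i, le i0 i -> `|jX (u i).1 f - p.1 f| < e) /\
      (forall e : R, 0 < e ->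
         exists i0, forall i, le i0 i -> dnorm (fun x => (u i).2 x - p.2 x) < e).

(* duality map J = subdifferential of (1/2)||.||^2 *)
Definition Jmap (X : normedModType R) : op X :=
  [set p | is_dual p.2 /\
     forall y : X, 2^-1 * `|p.1| ^+ 2 + p.2 (y - p.1) <= 2^-1 * `|y| ^+ 2].

Definition yosida (X : normedModType R) (T : op X) (lam : R) : op X :=
  [set p | exists z : (X -> R) -> R,
     is_bidual z /\ Ttilde T (z, p.2) /\
     (* 0 in lam x' + J~(z - x), i.e. -lam x' in J~(z - x) *)
     Ttilde (@Jmap X) (fun f => z f - f p.1, fun x => - (lam * p.2 x))].

Definition compose_op (Y X : normedModType R) (A : Y -> X) (S : op X) : op Y :=
  [set q | exists xs : X -> R, S (A q.1, xs) /\ q.2 = (fun y => xs (A y))].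

Definition liminf_op (Y : normedModType R) (S : nat -> op Y) : op Y :=
  [set q | is_dual q.2 /\
     exists u : nat -> Y * (Y -> R),
       (forall n, S n (u n)) /\
       (forall e : R, 0 < e -> exists N, forall n, (N <= n)%N ->
          `|(u n).1 - q.1| < e /\ dnorm (fun y => (u n).2 y - q.2 y) < e)].

Definition var_comp (Y X : normedModType R) (A : Y -> X) (T : op X) : op Y :=
  [set q | forall lam : nat -> R,
     (forall n, 0 < lam n) ->
     (forall e : R, 0 < e -> exists N, forall n, (N <= n)%N -> lam n < e) ->
     liminf_op (fun n => compose_op A (yosida T (lam n))) q].

Definition representable (Y : normedModType R) (S : op Y) : Prop :=
  exists h : Y * (Y -> R) -> \bar R,
    (forall (p q : Y * (Y -> R)) (t : R), is_dual p.2 -> is_dual q.2 ->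
       0 < t -> t < 1 ->
       let c := (t *: p.1 + (1 - t) *: q.1, fun y => t * p.2 y + (1 - t) * q.2 y) in
       (h c <= t%:E * h p + (1 - t)%:E * h q)%E) /\
    (exists p : Y * (Y -> R), is_dual p.2 /\ (h p < +oo)%E) /\
    (forall p, is_dual p.2 -> (-oo < h p)%E) /\
    (forall p, is_dual p.2 -> forall r : R, (r%:E < h p)%E ->
       exists e : R, 0 < e /\ forall q, is_dual q.2 ->
         `|q.1 - p.1| < e -> dnorm (fun y => q.2 y - p.2 y) < e ->
         (r%:E < h q)%E) /\
    (forall p, is_dual p.2 -> ((p.2 p.1)%:E <= h p)%E) /\
    S = [set p | is_dual p.2 /\ h p = (p.2 p.1)%:E].

End Defs.

(* Main.v *)
Require Import Defs.
From mathcomp Require Import all_boot all_order all_algebra.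
From mathcomp Require Import all_classical all_reals all_analysis.
From mathcomp Require Import ring lra.
Import numFieldNormedType.Exports.

(** Write [pi] for the duality product and
    [phi_S (p) = sup_(q in S) (pi (p) - pi (p - q))] for the Fitzpatrick function of an
    operator [S].  For a vanishing sequence [lam], put [S_n = A^* T_(lam_n) A].  The epi-upper limit of the functions
    [phi_(S_n)] is convex, lower semicontinuous and majorizes [pi]; the supremum of
    these functions over all [lam] represents the variational composition.  What has
    to be seen is that a point [p] with [phi_(S_n) (p) <= pi (p) + s^2] is within a
    fixed multiple of [s] of a point of [S_n].

    Since type (D) implies Simons' type (NI), Fenchel duality (Hahn-Banach) shows that
    [pi (q - p) + |q - p|^2 / 2] can be made arbitrarily small by points
    [q = (y, A^* f)], where [f] is almost a value of [T_lam] at [A y].  Iterating this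
    with geometrically decreasing errors gives a sequence along which [y] and [A^* f]
    are norm Cauchy, while [f] and the associated points [z] of [X] stay bounded; a
    generalized limit along an ultrafilter (weak* compactness of [X^*] and [X^**])
    turns it into an exact point of [S_n].  The same argument applied to the normal
    cone of [0] gives the density of the range of the duality mapping, hence the
    monotonicity of [T_lam]. *)

Set Implicit Arguments.
Unset Strict Implicit.
Unset Printing Implicit Defensive.
Import Order.TTheory GRing.Theory Num.Theory.
Local Open Scope classical_set_scope.
Local Open Scope ring_scope.

(** * Hahn-Banach: linear minorants of convex relations *)

Section HahnBanach.
Variables (R : realType) (V : lmodType R) (D : set V).
Variables (P : V -> R -> Prop) (e : R).
Hypothesis D0 : D 0.
Hypothesis P_total : forall v, D v -> exists a, P v a.
Hypothesis P_convex : forall u v a b t, P u a -> P v b -> 0 < t < 1 ->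
  P (t *: u + (1 - t) *: v) (t * a + (1 - t) * b).
Hypothesis P_lower : forall a, P 0 a -> e <= a.

(** Partial linear minorants are encoded by their graphs, so that the union of a chain is again one.
    Single-valuedness is not imposed; domination by [P] forces it later, in [Gfun]. *)
Let good (G : set (V * R)) :=
  (forall u v r s a, G (u, r) -> G (v, s) -> G (a *: u + v, a * r + s)) /\
  (forall v r a, G (v, r) -> P v a -> r + e <= a).

Let good_chain (F : set (set (V * R))) :
  F `<=` good -> total_on F subset -> good (\bigcup_(G in F) G).
Proof.
move=> Fg Ft; split=> [u v r s a [G FG Gu] [H FH Hv]|v r a [G FG Gv]].
  have [GH|HG] := Ft _ _ FG FH.
    by exists H => //; apply: (Fg _ FH).1 => //; exact: GH.
  by exists G => //; apply: (Fg _ FG).1 => //; exact: HG.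
exact: (Fg _ FG).2.
Qed.

(** The slope [c] along [w] has to exceed the lower bounds in [lo], given by negative multiples of
    [w], and stay below the upper bounds given by positive ones. Convexity of [P] orders the two
    families, and [c] is the supremum of the first. *)
Let good_extension (G : set (V * R)) (w : V) : D w -> D (- w) -> good G -> G (0, 0) ->
  exists c, good [set p | exists u r t, G (u, r) /\ p = (u + t *: w, r + t * c)].
Proof.
move=> Dw DNw [Glin Gdom] G0.
have GZ u r a : G (u, r) -> G (a *: u, a * r).
  by move=> Gu; have := Glin _ _ _ _ a Gu G0; rewrite !addr0.
pose lo := [set x | exists u r s a,
  [/\ G (u, r), 0 < s, P (u - s *: w) a & x = (r + e - a) / s]].
have lohi x u r t a : lo x -> G (u, r) -> 0 < t -> P (u + t *: w) a ->
    x <= (a - e - r) / t.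
  move=> [u' [r' [s [a' [Gu' s0 Pa' ->]]]]] Gu t0 Pa.
  have st0 : 0 < s + t by rewrite addr_gt0.
  (* With this weight the components [t *: w] and [- s *: w] cancel, so the convex combination lies
     over the domain of [G]. *)
  have tst : 0 < s / (s + t) < 1.
    by rewrite divr_gt0//= ltr_pdivrMr// mul1r ltrDl.
  have := P_convex Pa Pa' tst.
  have -> : 1 - s / (s + t) = t / (s + t) by field; lra.
  have -> : (s / (s + t)) *: (u + t *: w) + (t / (s + t)) *: (u' - s *: w) =
      (s / (s + t)) *: u + (t / (s + t)) *: u'.
    rewrite !scalerDr !scalerN !scalerA addrACA -scaleNr -scalerDl.
    have -> : s / (s + t) * t + - (t / (s + t) * s) = 0 by ring.
    by rewrite scale0r addr0.
  have /Gdom H := Glin _ _ _ _ (s / (s + t)) Gu (GZ _ _ (t / (s + t)) Gu').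
  move=> /H {}H.
  rewrite ler_pdivrMr// mulrAC ler_pdivlMr//.
  have := H; rewrite -(ler_pM2r st0).
  have -> : (s / (s + t) * r + t / (s + t) * r' + e) * (s + t) =
     s * r + t * r' + e * (s + t) by field; lra.
  have -> : (s / (s + t) * a + t / (s + t) * a') * (s + t) = s * a + t * a'.
    by field; lra.
  lra.
(* The value at [- w] makes [lo] non-empty and the value at [w] bounds it above, so [sup lo] is a
   genuine supremum. *)
have [a1 Pa1] := P_total Dw.
have [a2 Pa2] := P_total DNw.
have lo0 : lo !=set0.
  exists ((0 + e - a2) / 1); exists 0, 0, 1, a2; split => //.
  by rewrite scale1r sub0r.
have loub : has_ubound lo.
  exists ((a1 - e - 0) / 1) => x lox; apply: (lohi x 0 0 1 a1) => //.
  by rewrite scale1r add0r.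
exists (sup lo); split.
  move=> _ _ r s a [u [r1 [t1 [G1 [-> ->]]]]] [v [r2 [t2 [G2 [-> ->]]]]].
  exists (a *: u + v), (a * r1 + r2), (a * t1 + t2); split; first exact: Glin.
  congr (_, _); last by ring.
  by rewrite scalerDr scalerDl scalerA addrACA.
move=> _ _ a [u [r [t [Gu [-> ->]]]]] Pa.
have [t0|t0|t0] := ltrgtP t 0.
- have : (r + e - a) / (- t) <= sup lo.
    apply: ub_le_sup => //; exists u, r, (- t), a; split => //; first by lra.
    by rewrite scaleNr opprK.
  rewrite ler_pdivrMr; lra.
- have : sup lo <= (a - e - r) / t.
    by apply: ge_sup => // x lox; exact: (lohi x u r t a).
  rewrite ler_pdivlMr//; lra.
- by rewrite t0 mul0r addr0; apply: (Gdom u) => //; move: Pa; rewrite t0 scale0r addr0.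
Qed.

(* A convex relation plays the role of the epigraph of a convex function: an
   affine minorant exists as soon as the value at 0 is bounded from below. *)
Lemma convex_affine_minorant : (forall u v a, D u -> D v -> D (a *: u + v)) ->
  exists L : V -> R,
    (forall u v a, D u -> D v -> L (a *: u + v) = a * L u + L v) /\
    (forall v a, D v -> P v a -> L v + e <= a).
Proof.
move=> Dlin.
have [G [Gg Gmax]] := Zorn_bigcup good_chain.
have [Glin Gdom] := Gg.
(* The empty set is [good] too, so it takes maximality to put the origin into [G]. *)
have G0 : G (0, 0).
  have [[[u r] Gu]|nG] := pselect (exists p, G p).
    by have := Glin _ _ _ _ (-1) Gu Gu; rewrite scaleN1r addNr mulN1r addNr.
  exfalso; apply: (Gmax [set (0, 0)]).
    split; first by move=> p Gp; case: nG; exists p.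
    by move=> H; apply: nG; exists (0, 0); exact: H.
  split; first by move=> _ _ _ _ a [-> ->] [-> ->]; rewrite scaler0 mulr0 !addr0.
  by move=> _ _ a [-> ->] Pa; rewrite add0r; exact: P_lower.
(* A nonzero vertical element [(0, r - s)] could be rescaled to height [a - e + 1], against
   domination at 0. *)
have Gfun v r s : G (v, r) -> G (v, s) -> r = s.
  move=> Gr Gs; apply/eqP; rewrite -subr_eq0; apply: contrapT => /negP rs.
  have [a Pa] := P_total D0.
  have G1 : G (0, r - s).
    have := Glin _ _ _ _ (-1) Gs Gr.
    by rewrite scaleN1r addNr mulN1r addrC.
  have := Glin _ _ _ _ ((a - e + 1) / (r - s)) G1 G0.
  rewrite scaler0 !addr0 divfK// => /Gdom/(_ Pa).
  lra.
have Gtot v : D v -> exists r, G (v, r).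
  move=> Dv; apply: contrapT => nG.
  have DNv : D (- v) by have := Dlin _ _ (-1) Dv D0; rewrite scaleN1r addr0.
  have [c gc] := good_extension Dv DNv Gg G0.
  apply: (Gmax _ _ gc); split.
    by move=> [u r] Gu; exists u, r, 0; rewrite scale0r mul0r !addr0.
  move=> /(_ (v, c)) H; apply: nG; exists c; apply: H.
  by exists 0, 0, 1; split=> //; rewrite scale1r mul1r !add0r.
exists (fun v => xget 0 [set r | G (v, r)]).
have GL v : D v -> G (v, xget 0 [set r | G (v, r)]).
  by move=> /Gtot [r Gr]; exact: (@xgetI _ 0 [set r | G (v, r)] r Gr).
split=> [u v a Du Dv|v a Dv Pv]; last exact: (Gdom v _ _ (GL _ Dv)).
apply: (Gfun (a *: u + v)); first exact/GL/Dlin.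
by apply: Glin; exact: GL.
Qed.

End HahnBanach.

(** * Continuous linear functionals, the dual norm and the bidual *)

Section Dual.
Variables (R : realType) (X : normedModType R).
Implicit Types (f g : X -> R) (x y : X) (z : (X -> R) -> R).

Lemma dualD f x y : is_dual f -> f (x + y) = f x + f y.
Proof. by case. Qed.

Lemma dualZ f a x : is_dual f -> f (a *: x) = a * f x.
Proof. by case=> _ []. Qed.

Lemma dual0 f : is_dual f -> f 0 = 0.
Proof. by move=> df; rewrite -(scale0r 0) dualZ// mul0r. Qed.

Lemma dualN f x : is_dual f -> f (- x) = - f x.
Proof. by move=> df; rewrite -scaleN1r dualZ// mulN1r. Qed.

Lemma dualB f x y : is_dual f -> f (x - y) = f x - f y.
Proof. by move=> df; rewrite dualD// dualN. Qed.

Lemma dual_bounded f : is_dual f -> exists2 M, 0 <= M & forall x, `|f x| <= M * `|x|.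
Proof.
move=> df; have [_ [_ /(_ 0)]] := df.
move=> /cvgrPdist_lt/(_ 1 ltr01)/nbhs_ballP[d /= d0 fd].
exists (2 / d) => [|x]; first by rewrite divr_ge0// ltW.
have [->|x0] := eqVneq x 0; first by rewrite dual0// normr0 normr0 mulr0.
have nx : 0 < `|x| by rewrite normr_gt0.
have [c c0 cx] : exists2 c, 0 < c & c * `|x| = d / 2.
  by exists (d / 2 / `|x|); rewrite ?divr_gt0// divfK// gt_eqF.
have := fd (c *: x); rewrite -ball_normE/= sub0r normrN normrZ.
rewrite dual0// sub0r normrN dualZ// normrM !(gtr0_norm c0) cx.
have dd : d / 2 < d by lra.
move=> /(_ dd)/ltW fx.
rewrite -(ler_pM2l c0) mulrCA cx (le_trans fx)//.
by have -> : 2 / d * (d / 2) = 1 by field; rewrite gt_eqF.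
Qed.

Lemma bounded_dual f M : (forall x y, f (x + y) = f x + f y) ->
  (forall a x, f (a *: x) = a * f x) -> (forall x, `|f x| <= M * `|x|) -> is_dual f.
Proof.
move=> fD fZ fM; split=> //; split=> // x; apply/cvgrPdist_lt => e e0.
have M1 : 0 < `|M| + 1 by rewrite ltr_pwDr.
apply/nbhs_ballP; exists (e / (`|M| + 1)) => /=; first by rewrite divr_gt0.
move=> y; rewrite -ball_normE/= ltr_pdivlMr// => xy.
have -> : f x - f y = f (x - y) by rewrite fD -(scaleN1r y) fZ mulN1r.
apply: le_lt_trans (fM _) _; apply: le_lt_trans xy.
by rewrite mulrC ler_wpM2l// (le_trans (ler_norm _))// lerDl.
Qed.

Let dnorm_has_sup f : is_dual f ->
  has_sup [set `|f x| | x in [set x : X | `|x| <= 1]].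
Proof.
move=> df; split; first by exists `|f 0|, 0 => //=; rewrite normr0.
have [M M0 fM] := dual_bounded df.
by exists M => _ [x /= x1 <-]; rewrite (le_trans (fM _))// ler_piMr.
Qed.

Lemma dnorm_nneg f : is_dual f -> 0 <= dnorm f.
Proof.
move=> df; rewrite -(normr0 R) -(dual0 df); apply: ub_le_sup.
  by case: (dnorm_has_sup df).
by exists 0 => //=; rewrite normr0.
Qed.

Lemma ler_dnorm f x : is_dual f -> `|f x| <= dnorm f * `|x|.
Proof.
move=> df; have [->|x0] := eqVneq x 0; first by rewrite dual0// !normr0 mulr0.
have nx : 0 < `|x| by rewrite normr_gt0.
rewrite -ler_pdivrMr//; apply: ub_le_sup; first by case: (dnorm_has_sup df).
exists (`|x|^-1 *: x) => /=.
  by rewrite normrZ ger0_norm ?invr_ge0// mulVf ?gt_eqF.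
by rewrite dualZ// normrM ger0_norm ?invr_ge0// mulrC.
Qed.

Lemma dual_le f x : is_dual f -> f x <= dnorm f * `|x|.
Proof. by move=> df; rewrite (le_trans (ler_norm _))// ler_dnorm. Qed.

Lemma dual_ge f x : is_dual f -> - (dnorm f * `|x|) <= f x.
Proof.
by move=> df; rewrite lerNl -(dualN x df) (le_trans (dual_le _ df))// normrN.
Qed.

Lemma dnorm_le f M : 0 <= M -> (forall x, `|f x| <= M * `|x|) -> dnorm f <= M.
Proof.
move=> M0 fM; apply: ge_sup; first by exists `|f 0|, 0 => //=; rewrite normr0.
by move=> _ [x /= x1 <-]; rewrite (le_trans (fM _))// ler_piMr.
Qed.

Lemma is_dualZD f g a : is_dual f -> is_dual g -> is_dual (fun x => a * f x + g x).
Proof.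
move=> df dg.
apply: (@bounded_dual _ (`|a| * dnorm f + dnorm g)) => [x y|b x|x].
- by rewrite !dualD//; ring.
- by rewrite !dualZ//; ring.
- rewrite (le_trans (ler_normD _ _))// mulrDl normrM -mulrA.
  by rewrite lerD ?ler_wpM2l ?ler_dnorm.
Qed.

Lemma is_dual_cst0 : is_dual (fun _ : X => 0 : R).
Proof.
by apply: (@bounded_dual _ 0) => * /=; rewrite ?addr0 ?mulr0 ?normr0 ?mul0r.
Qed.

Lemma is_dualD f g : is_dual f -> is_dual g -> is_dual (fun x => f x + g x).
Proof.
move=> df dg; have := is_dualZD 1 df dg; congr is_dual.
by apply/funext => x; rewrite mul1r.
Qed.

Lemma is_dualZ f a : is_dual f -> is_dual (fun x => a * f x).
Proof.
move=> df; have := is_dualZD a df is_dual_cst0; congr is_dual.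
by apply/funext => x; rewrite addr0.
Qed.

Lemma is_dualN f : is_dual f -> is_dual (fun x => - f x).
Proof.
move=> df; have := is_dualZ (-1) df; congr is_dual.
by apply/funext => x; rewrite mulN1r.
Qed.

Lemma is_dualB f g : is_dual f -> is_dual g -> is_dual (fun x => f x - g x).
Proof. by move=> df dg; exact/is_dualD/is_dualN. Qed.

Lemma is_dual_conv f g t : is_dual f -> is_dual g ->
  is_dual (fun x => t * f x + (1 - t) * g x).
Proof. by move=> df dg; exact/is_dualZD/is_dualZ. Qed.

Lemma dnorm_cst0 : dnorm (fun _ : X => 0 : R) = 0.
Proof.
apply/eqP; rewrite eq_le dnorm_nneg ?andbT; last exact: is_dual_cst0.
by apply: dnorm_le => // x; rewrite normr0 mul0r.
Qed.

Lemma dnormZ_le f a : is_dual f -> dnorm (fun x => a * f x) <= `|a| * dnorm f.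
Proof.
move=> df; apply: dnorm_le => [|x]; first by rewrite mulr_ge0// dnorm_nneg.
by rewrite normrM -mulrA ler_wpM2l// ler_dnorm.
Qed.

Lemma dnormD_le f g : is_dual f -> is_dual g ->
  dnorm (fun x => f x + g x) <= dnorm f + dnorm g.
Proof.
move=> df dg; apply: dnorm_le => [|x]; first by rewrite addr_ge0// dnorm_nneg.
by rewrite mulrDl (le_trans (ler_normD _ _))// lerD// ler_dnorm.
Qed.

Lemma dnormBC f g : dnorm (fun x => f x - g x) = dnorm (fun x => g x - f x).
Proof.
rewrite /dnorm; congr sup; apply/seteqP; split=> _ [x x1 <-]; exists x => //;
  exact: distrC.
Qed.

Lemma dnormB_trans f g h : is_dual f -> is_dual g -> is_dual h ->
  dnorm (fun x => f x - h x) <= dnorm (fun x => f x - g x) + dnorm (fun x => g x - h x).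
Proof.
move=> df dg dh; have := dnormD_le (is_dualB df dg) (is_dualB dg dh).
by congr (dnorm _ <= _); apply/funext => x; ring.
Qed.

(** Young's inequality: the quadratic terms in [x] and in [f] are Fenchel conjugates of each
    other. *)
Lemma dual_quadratic_ge f l x : 0 < l -> is_dual f ->
  0 <= `|x| ^+ 2 / (2 * l) + l / 2 * dnorm f ^+ 2 + f x.
Proof.
move=> l0 df; have := dual_ge x df.
have : 0 <= (`|x| - l * dnorm f) ^+ 2 / (2 * l).
  by rewrite divr_ge0 ?sqr_ge0// mulr_ge0// ltW.
have -> : (`|x| - l * dnorm f) ^+ 2 / (2 * l) =
  `|x| ^+ 2 / (2 * l) + l / 2 * dnorm f ^+ 2 - dnorm f * `|x| by field; lra.
lra.
Qed.

(** Young's inequality is sharp up to [e]. The norm of [f] need not be attained, so a nearly norming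
    vector of the unit ball is scaled by [- (l * n)]. *)
Lemma dual_quadratic_inf f l e : 0 < l -> 0 < e -> is_dual f ->
  exists x, `|x| ^+ 2 / (2 * l) + l / 2 * dnorm f ^+ 2 + f x < e.
Proof.
move=> l0 e0 df; have n0 := dnorm_nneg df; set n := dnorm f.
(* The tolerance [e / (l * n + 1)] stays below [e] after multiplication by [l * n], even when [n] is
   0. *)
have [x x1 fx] : exists2 x, `|x| <= 1 & n - e / (l * n + 1) < f x.
  have d0 : 0 < e / (l * n + 1) by rewrite divr_gt0// ltr_wpDl// mulr_ge0// ltW.
  have [_ [x /= x1 <-] fx] := sup_adherent d0 (dnorm_has_sup df).
  have [f0|f0] := leP 0 (f x); first by exists x => //; rewrite -(ger0_norm f0).
  by exists (- x); rewrite ?normrN// dualN// -(ltr0_norm f0).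
exists (- (l * n) *: x); rewrite normrZ normrN ger0_norm ?mulr_ge0 ?(ltW l0)//.
rewrite dualZ// exprMn.
have l1 : 0 < l * n + 1 by rewrite ltr_wpDl// mulr_ge0// ltW.
have ln : 0 <= l * n by rewrite mulr_ge0// ltW.
have x2 : `|x| ^+ 2 <= 1 by rewrite expr_le1.
have H1 : (l * n) ^+ 2 * `|x| ^+ 2 / (2 * l) <= l / 2 * n ^+ 2.
  have -> : (l * n) ^+ 2 * `|x| ^+ 2 / (2 * l) = l / 2 * n ^+ 2 * `|x| ^+ 2.
    by field; lra.
  by rewrite ler_piMr// mulr_ge0 ?sqr_ge0//; lra.
have H2 : (l * n) * (n - e / (l * n + 1)) <= l * n * f x by rewrite ler_wpM2l// ltW.
have H3 : l * n * (e / (l * n + 1)) < e.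
  by rewrite mulrA ltr_pdivrMr// mulrC ltr_pM2l// ltrDl.
rewrite mulNr; move: H1 H2 H3; rewrite -/n mulrBr expr2; lra.
Qed.

Lemma jX_bidual x : is_bidual (jX x).
Proof.
split; first by [].
split; first by [].
by exists `|x| => f df; rewrite mulrC ler_dnorm.
Qed.

Lemma bidualB z f g : is_bidual z -> is_dual f -> is_dual g ->
  z (fun x => f x - g x) = z f - z g.
Proof.
move=> [zD [zZ _]] df dg; rewrite zD//; last exact: is_dualN.
have -> : (fun x => - g x) = (fun x => -1 * g x) by apply/funext => x; rewrite mulN1r.
by rewrite zZ// mulN1r.
Qed.

Lemma bidual_le z : is_bidual z ->
  exists2 C, 0 <= C & forall f, is_dual f -> `|z f| <= C * dnorm f.
Proof.
move=> [_ [_ [C zC]]]; exists `|C| => // f df.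
by rewrite (le_trans (zC _ df))// ler_wpM2r ?dnorm_nneg// ler_norm.
Qed.

End Dual.

(** * Generalized limits of bounded real sequences *)

Section GeneralizedLimit.
Variable R : realType.
Implicit Types u v : nat -> R.

Definition bounded_seq u := exists M, forall n, `|u n| <= M.

(** The limit is taken along an ultrafilter finer than [eventually]; compactness of segments makes
    every bounded sequence converge along it. *)
Lemma generalized_limit : exists LIM : (nat -> R) -> R,
  [/\ forall u v, bounded_seq u -> bounded_seq v ->
        LIM (fun n => u n + v n) = LIM u + LIM v,
      forall a u, bounded_seq u -> LIM (fun n => a * u n) = a * LIM u,
      forall a, LIM (fun=> a) = a &
      forall u v N, bounded_seq u -> bounded_seq v ->
        (forall n, (N <= n)%N -> u n <= v n) -> LIM u <= LIM v].
Proof.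
have [G [GU sG]] := ultraFilterLemma (eventually_filter : ProperFilter eventually).
have GF : ProperFilter G by exact: ultra_proper.
have lim_ex u : bounded_seq u -> exists l : R, u @ G --> l.
  move=> [M uM]; have := @segment_compact R (- M) M.
  rewrite compact_ultra => /(_ (u @ G) _ _).
  have GuU : UltraFilter (u @ G).
    split; first exact: fmap_proper_filter.
    move=> H HF GH; apply/seteqP; split=> // A HA.
    have [//|nA] := in_ultra_setVsetC (u @^-1` A) GU.
    exfalso; apply: (@filter_not_empty _ H _).
    have : H (A `&` ~` A) by apply: filterI => //; apply: GH.
    by rewrite setICr.
  move=> /(_ GuU)[]; last by move=> l [_ ul]; exists l.
  by apply: (@filterE _ G _) => n /=; rewrite in_itv/= -ler_norml; exact: uM.
pose LIM u := xget 0 [set l : R | u @ G --> l].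
have LIMP u : bounded_seq u -> u @ G --> LIM u.
  by move=> /lim_ex [l ul]; exact: (@xgetI _ 0 [set l : R | u @ G --> l] l ul).
have LIM_eq u l : u @ G --> l -> LIM u = l.
  move=> ul; apply: (@cvg_unique _ _ (u @ G) _ (LIM u) l) => //.
  exact: (@xgetI _ 0 [set l : R | u @ G --> l] l ul).
exists LIM; split.
- by move=> u v /LIMP bu /LIMP bv; apply: LIM_eq; exact: cvgD.
- by move=> a u /LIMP bu; apply: LIM_eq; exact: cvgM (cvg_cst a) bu.
- by move=> a; apply: LIM_eq; exact: cvg_cst.
- move=> u v N /LIMP bu /LIMP bv uv; apply: (ler_cvg_to bu bv).
  by apply: sG; exists N.
Qed.

End GeneralizedLimit.

(** * Type (D), type (NI) and the Fitzpatrick function on the bidual *)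

Section TypeNI.
Variables (R : realType) (X : normedModType R).
Implicit Types (T : op X) (f : X -> R) (z : (X -> R) -> R).

(* Simons' type (NI): the Fitzpatrick function of [T], extended to the bidual,
   majorizes the duality product. *)
Definition typeNI T := forall z f rho, is_bidual z -> is_dual f ->
  (forall q, T q -> z q.2 + f q.1 - q.2 q.1 <= rho) -> z f <= rho.

Lemma Ttilde_fitzpatrick T z f : in_graph_space T ->
  Ttilde T (z, f) <-> [/\ is_bidual z, is_dual f &
    forall q, T q -> z q.2 + f q.1 - q.2 q.1 <= z f].
Proof.
move=> Tg; split=> [[/= bz [df H]]|[bz df H]].
  by split=> // q Tq; have := H q Tq; rewrite bidualB//; [lra|exact: Tg].
split=> //; split=> // q Tq /=; have := H q Tq.
by rewrite bidualB//; [lra|exact: Tg].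
Qed.

(** A violation of (NI) at [(z, f)] puts this pair in [Ttilde T]. At a point [u i] of the
    approximating net, with [g] the difference of [f] and [(u i).2], the bounded quantity equals
    [z f - z g + g (u i).1], which tends to [z f] and so exceeds [rho]. *)
Lemma typeD_typeNI T : in_graph_space T -> typeD T -> typeNI T.
Proof.
move=> Tg TD z f rho bz df H; rewrite leNgt; apply/negP => rz.
have Tzf : Ttilde T (z, f).
  by apply/Ttilde_fitzpatrick => //; split=> // q /H; lra.
have [I [le [u [[i0] [le_refl [_ [_ [Tu [[M uM] [_ uf]]]]]]]]]] := TD _ Tzf.
have [C C0 zC] := bidual_le bz.
have M0 : 0 <= M by apply: le_trans (uM i0).1.
have CM : 0 < C + M + 1 by lra.
(* [C] bounds [z] and [M] bounds the net, so the total error is at most [(C + M) * dnorm g], less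
   than [z f - rho]. *)
have d0 : 0 < (z f - rho) / (C + M + 1) by rewrite divr_gt0// subr_gt0.
have [i1 /(_ i1 (le_refl _))] := uf _ d0.
rewrite /= dnormBC; set g := fun x => f x - (u i1).2 x => gd.
have du := Tg _ (Tu i1).
have dg : is_dual g by exact: is_dualB.
have := H _ (Tu i1).
have zg := le_trans (ler_norm _) (zC _ dg).
have gu := dual_ge (u i1).1 dg.
have gM : dnorm g * `|(u i1).1| <= dnorm g * M.
  by rewrite ler_wpM2l ?dnorm_nneg//; exact: (uM i1).1.
move: zg gu gd; rewrite ltr_pdivlMr// bidualB// /g => zg gu gd.
have := dnorm_nneg dg; rewrite /g in gM *.
lra.
Qed.

Lemma typeNI_fitzpatrick_ge T x f rho : typeNI T -> is_dual f ->
  (forall q, T q -> q.2 x + f q.1 - q.2 q.1 <= rho) -> f x <= rho.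
Proof. by move=> TN df; apply: (TN (jX x)) => //; exact: jX_bidual. Qed.

(** For an empty graph every [rho] is an admissible bound; at the origin [rho = -1] would give
    [0 <= -1]. *)
Lemma typeNI_nonempty T : typeNI T -> T !=set0.
Proof.
move=> TN; apply: contrapT => T0.
have : (0 : R) <= -1.
  apply: (typeNI_fitzpatrick_ge (x := 0) TN (@is_dual_cst0 R X)) => q Tq.
  by case: T0; exists q.
by rewrite lerNr oppr0 ler10.
Qed.

(* The midpoint of two points with negative duality product of the difference
   would violate (NI). *)
Lemma typeNI_Ttilde_monotone T z1 z2 f1 f2 : in_graph_space T -> typeNI T ->
  Ttilde T (z1, f1) -> Ttilde T (z2, f2) ->
  0 <= z1 f1 - z1 f2 - z2 f1 + z2 f2.
Proof.
move=> Tg TN /(Ttilde_fitzpatrick _ _ Tg)[bz1 df1 H1].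
move=> /(Ttilde_fitzpatrick _ _ Tg)[bz2 df2 H2].
have [[zD1 [zZ1 [C1 zC1]]] [zD2 [zZ2 [C2 zC2]]]] := (bz1, bz2).
pose z f := 2^-1 * (z1 f + z2 f).
have bz : is_bidual z.
  split; first by move=> f g df dg; rewrite /z zD1// zD2//; ring.
  split; first by move=> a f df; rewrite /z zZ1// zZ2//; ring.
  exists (2^-1 * (C1 + C2)) => f df; rewrite /z normrM ger0_norm; last by lra.
  rewrite -mulrA ler_wpM2l//.
  by rewrite mulrDl (le_trans (ler_normD _ _))// lerD ?zC1 ?zC2.
pose f x := 2^-1 * f1 x + (1 - 2^-1) * f2 x.
have := TN z f (2^-1 * (z1 f1 + z2 f2)) bz (is_dual_conv _ df1 df2).
have -> : z f = 2^-1 * (2^-1 * (z1 f1 + z1 f2) + 2^-1 * (z2 f1 + z2 f2)).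
  have d1 : is_dual (fun x => 2^-1 * f1 x) by exact: is_dualZ.
  have d2 : is_dual (fun x => (1 - 2^-1) * f2 x) by exact: is_dualZ.
  by rewrite /z /f zD1// zD2// !zZ1// !zZ2//; field.
have H q : T q -> z q.2 + f q.1 - q.2 q.1 <= 2^-1 * (z1 f1 + z2 f2).
  by move=> Tq; have := H1 q Tq; have := H2 q Tq; rewrite /z /f; lra.
by move=> /(_ H); lra.
Qed.

End TypeNI.

(** * Convexity inequalities and bounded linear maps *)

Section ConvexityBounds.
Variable R : realType.

Lemma sqr_convex (a b c t : R) : 0 <= a -> 0 < t < 1 -> a <= t * b + (1 - t) * c ->
  a ^+ 2 <= t * b ^+ 2 + (1 - t) * c ^+ 2.
Proof.
move=> a0 /andP[t0 t1] abc.
have H : a ^+ 2 <= (t * b + (1 - t) * c) ^+ 2 by rewrite lerXn2r// nnegrE (le_trans a0).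
apply: le_trans H _; rewrite -subr_ge0.
have -> : t * b ^+ 2 + (1 - t) * c ^+ 2 - (t * b + (1 - t) * c) ^+ 2 =
  t * (1 - t) * (b - c) ^+ 2 by ring.
by rewrite mulr_ge0 ?sqr_ge0// mulr_ge0 ?subr_ge0//; exact: ltW.
Qed.

(** Continuity of a linear functional follows from one-sided quadratic growth along lines: test [t]
    at plus and minus [n^-1]. When [n] is 0, a linear function of [t] bounded above vanishes. *)
Lemma quadratic_growth_bound (a C c n : R) : 0 <= n ->
  (forall t, t * a <= C + c * (t * n) ^+ 2) -> `|a| <= (C + c) * n.
Proof.
move=> n0 H; have [n1|n1] := eqVneq n 0.
  rewrite n1 mulr0; have [->|a0] := eqVneq a 0; first by rewrite normr0.
  by have := H ((C + 1) / a); rewrite divfK// n1 mulr0 expr0n mulr0; lra.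
have np : 0 < n by rewrite lt_def n1.
rewrite -ler_pdivrMr// -[X in _ / X](gtr0_norm np) -normf_div ler_norml.
have := H n^-1; have := H (- n^-1).
rewrite !mulNr mulVf// sqrrN expr1n mulr1 (mulrC n^-1 a) => *.
by apply/andP; split; lra.
Qed.

Lemma dnorm_conv_le (X : normedModType R) (f g : X -> R) t : is_dual f -> is_dual g ->
  0 < t < 1 ->
  dnorm (fun x => t * f x + (1 - t) * g x) <= t * dnorm f + (1 - t) * dnorm g.
Proof.
move=> df dg /andP[t0 t1].
have := dnormD_le (is_dualZ t df) (is_dualZ (1 - t) dg).
have := dnormZ_le t df; have := dnormZ_le (1 - t) dg.
rewrite (gtr0_norm t0) ger0_norm; lra.
Qed.

Lemma norm_conv_le (X : normedModType R) (x y : X) t : 0 < t < 1 ->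
  `|t *: x + (1 - t) *: y| <= t * `|x| + (1 - t) * `|y|.
Proof.
move=> /andP[t0 t1]; rewrite (le_trans (ler_normD _ _))// !normrZ.
by rewrite (gtr0_norm t0) gtr0_norm// subr_gt0.
Qed.

Lemma continuous_linear_le (X Y : normedModType R) (A : {linear Y -> X}) :
  continuous A -> exists2 M, 0 <= M & forall y, `|A y| <= M * `|y|.
Proof.
move=> /linear_bounded_continuous/linear_boundedP/pinfty_ex_gt0[M M0 AM].
by exists M => //; exact: ltW.
Qed.

Lemma is_dual_comp (X Y : normedModType R) (A : {linear Y -> X}) (f : X -> R) :
  continuous A -> is_dual f -> is_dual (fun y => f (A y)).
Proof.
move=> /continuous_linear_le[M M0 AM] df.
apply: (@bounded_dual _ _ _ (dnorm f * M)) => [x y|a x|x].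
- by rewrite linearD (dualD _ _ df).
- by rewrite linearZ (dualZ _ _ df).
- rewrite (le_trans (ler_dnorm _ df))// -mulrA ler_wpM2l//.
  exact: dnorm_nneg.
Qed.

End ConvexityBounds.

(** * Approximate Minty theorem for the composed regularization, by Fenchel duality *)

Section ApproximateMinty.
Variables (R : realType) (X Y : normedModType R) (T : op X) (A : {linear Y -> X}).
Hypotheses (Tg : in_graph_space T) (Tm : monotone_op T) (TN : typeNI T).
Hypothesis Ac : continuous A.

(** Epigraph of the Fitzpatrick function of [S]; a relation avoids the value +oo. *)
Definition fitz_epi (S : op X) (z : X) (f : X -> R) (r : R) :=
  is_dual f /\ forall q, S q -> q.2 z + f q.1 - q.2 q.1 <= r.

Lemma fitz_epi_conv S z1 z2 f1 f2 r1 r2 t : in_graph_space S -> 0 < t < 1 ->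
  fitz_epi S z1 f1 r1 -> fitz_epi S z2 f2 r2 ->
  fitz_epi S (t *: z1 + (1 - t) *: z2) (fun x => t * f1 x + (1 - t) * f2 x)
    (t * r1 + (1 - t) * r2).
Proof.
move=> Sg /andP[t0 t1] [d1 H1] [d2 H2]; split; first exact: is_dual_conv.
move=> q Sq; have dq := Sg _ Sq; rewrite (dualD _ _ dq) !(dualZ _ _ dq).
have h1 : 0 <= t * (r1 - (q.2 z1 + f1 q.1 - q.2 q.1)).
  by rewrite mulr_ge0 ?subr_ge0 ?H1// ltW.
have h2 : 0 <= (1 - t) * (r2 - (q.2 z2 + f2 q.1 - q.2 q.1)).
  by rewrite mulr_ge0 ?subr_ge0 ?H2// ltW.
lra.
Qed.

Lemma monotone_fitz_epi q : T q -> fitz_epi T q.1 q.2 (q.2 q.1).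
Proof.
move=> Tq; split=> [|q' Tq']; first exact: Tg.
have := Tm Tq Tq'; rewrite (dualB _ _ (Tg Tq)) (dualB _ _ (Tg Tq')); lra.
Qed.

(** A Young function of [z - A y] plus its conjugate at [- f]. It is at least [f (A y) - f z], with
    equality exactly when [- l f] is in the duality mapping at [z - A y]. Hence
    [r + yosida_energy l y z f - f (A y)] measures the failure of [f] to be a Yosida value at
    [A y]. *)
Definition yosida_energy (l : R) (y : Y) (z : X) (f : X -> R) : R :=
  `|A y - z| ^+ 2 / (2 * l) + l / 2 * dnorm f ^+ 2.

Lemma yosida_energy_convex l y1 y2 z1 z2 f1 f2 t : 0 < l -> is_dual f1 -> is_dual f2 ->
  0 < t < 1 ->
  yosida_energy l (t *: y1 + (1 - t) *: y2) (t *: z1 + (1 - t) *: z2)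
    (fun x => t * f1 x + (1 - t) * f2 x) <=
  t * yosida_energy l y1 z1 f1 + (1 - t) * yosida_energy l y2 z2 f2.
Proof.
move=> l0 d1 d2 t01; rewrite /yosida_energy.
have h1 : `|A (t *: y1 + (1 - t) *: y2) - (t *: z1 + (1 - t) *: z2)| ^+ 2 <=
    t * `|A y1 - z1| ^+ 2 + (1 - t) * `|A y2 - z2| ^+ 2.
  apply: sqr_convex => //; rewrite (le_trans _ (norm_conv_le _ _ t01))//.
  by rewrite linearD !linearZ !scalerBr opprD addrACA.
have h2 : dnorm (fun x => t * f1 x + (1 - t) * f2 x) ^+ 2 <=
    t * dnorm f1 ^+ 2 + (1 - t) * dnorm f2 ^+ 2.
  by apply: sqr_convex (dnorm_conv_le _ _ _) => //; exact/dnorm_nneg/is_dual_conv.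
move: (`|A _ - _|) (`|A y1 - _|) (`|A y2 - _|) h1 => a a1 a2 h1.
move: (dnorm _) (dnorm f1) (dnorm f2) h2 => b b1 b2 h2.
rewrite -subr_ge0.
have -> : t * (a1 ^+ 2 / (2 * l) + l / 2 * b1 ^+ 2) +
    (1 - t) * (a2 ^+ 2 / (2 * l) + l / 2 * b2 ^+ 2) -
    (a ^+ 2 / (2 * l) + l / 2 * b ^+ 2) =
  (t * a1 ^+ 2 + (1 - t) * a2 ^+ 2 - a ^+ 2) / (2 * l) +
  l / 2 * (t * b1 ^+ 2 + (1 - t) * b2 ^+ 2 - b ^+ 2) by ring.
by rewrite addr_ge0// ?divr_ge0 ?mulr_ge0 ?subr_ge0// ?divr_ge0// ?mulr_ge0// ltW.
Qed.

Variables (l : R) (x0 : Y) (g0 : Y -> R).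
Hypotheses (l0 : 0 < l) (dg0 : is_dual g0).

(** The objective of [approximate_minty] without [r]. The bilinear term [k (A y)] of the gap cancels
    against the one in the duality product with [(x0, g0)], which is why [G] is jointly convex. *)
Let G (y : Y) (u : X) (k : X -> R) := yosida_energy l y u k - k (A x0) - g0 y + g0 x0 +
  `|y - x0| ^+ 2 / 2 + dnorm (fun v => k (A v) - g0 v) ^+ 2 / 2.

Let G_convex y1 y2 u1 u2 k1 k2 t : is_dual k1 -> is_dual k2 -> 0 < t < 1 ->
  G (t *: y1 + (1 - t) *: y2) (t *: u1 + (1 - t) *: u2)
    (fun x => t * k1 x + (1 - t) * k2 x) <= t * G y1 u1 k1 + (1 - t) * G y2 u2 k2.
Proof.
move=> d1 d2 t01; rewrite /G.
have h1 := yosida_energy_convex y1 y2 u1 u2 l0 d1 d2 t01.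
have h2 : `|t *: y1 + (1 - t) *: y2 - x0| ^+ 2 <=
    t * `|y1 - x0| ^+ 2 + (1 - t) * `|y2 - x0| ^+ 2.
  apply: sqr_convex => //; rewrite (le_trans _ (norm_conv_le _ _ t01))//.
  by rewrite !scalerBr addrACA -opprD -scalerDl subrKC scale1r.
have h4 : dnorm (fun v => t * k1 (A v) + (1 - t) * k2 (A v) - g0 v) ^+ 2 <=
    t * dnorm (fun v => k1 (A v) - g0 v) ^+ 2 +
    (1 - t) * dnorm (fun v => k2 (A v) - g0 v) ^+ 2.
  have -> : (fun v => t * k1 (A v) + (1 - t) * k2 (A v) - g0 v) =
      (fun v => t * (k1 (A v) - g0 v) + (1 - t) * (k2 (A v) - g0 v)).
    by apply/funext => v; ring.
  have da1 : is_dual (fun v => k1 (A v) - g0 v).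
    by apply: is_dualB => //; exact: is_dual_comp.
  have da2 : is_dual (fun v => k2 (A v) - g0 v).
    by apply: is_dualB => //; exact: is_dual_comp.
  by apply: sqr_convex (dnorm_conv_le _ _ _) => //; exact/dnorm_nneg/is_dual_conv.
by rewrite (dualD _ _ dg0) !(dualZ _ _ dg0); lra.
Qed.

(** If the infimum were at least [e], decoupling the arguments of the Fitzpatrick function from
    those of [G] and applying Hahn-Banach would give a dual point in the bidual times the dual. (NI)
    at this point, with nearly optimal [y] and [u], contradicts the lower bound [e]. *)
Lemma approximate_minty e : 0 < e -> exists y z f r, fitz_epi T z f r /\
  r + yosida_energy l y z f - f (A y) +
  (f (A (y - x0)) - g0 (y - x0) + `|y - x0| ^+ 2 / 2 +
    dnorm (fun v => f (A v) - g0 v) ^+ 2 / 2) <= e.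
Proof.
move=> e0; apply: contrapT => nE.
have lowG y z f r : fitz_epi T z f r -> e <= r + G y z f.
  move=> Ef; rewrite leNgt; apply/negP => /ltW Ge; apply: nE.
  exists y, z, f, r; split=> //; apply: le_trans Ge; rewrite /G.
  by have [df _] := Ef; rewrite linearB (dualB _ _ df) (dualB _ _ dg0); lra.
(* The module contains all functions on [X]; [D] selects those that are continuous and linear. *)
pose V : lmodType R := (X * (X -> R^o))%type.
pose D : set V := fun v => is_dual v.2.
(* Values of the perturbed problem: [v] is the discrepancy between [(z, f)], seen by the Fitzpatrick
   function, and [(u, k)], seen by [G]. *)
pose P (v : V) (a : R) := exists y u k z f r, [/\ fitz_epi T z f r, is_dual k,
  z - u = v.1, forall x, f x - k x = v.2 x & r + G y u k <= a].
have D0 : D 0 by exact: is_dual_cst0.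
have Dlin u v a : D u -> D v -> D (a *: u + v) by move=> du dv; exact: is_dualZD.
have [q Tq] := typeNI_nonempty TN.
have Eq := monotone_fitz_epi Tq.
have dq := Tg Tq.
have Ptot v : D v -> exists a, P v a.
  move=> Dv; exists (q.2 q.1 + G 0 (q.1 - v.1) (fun x => q.2 x - v.2 x)).
  exists 0, (q.1 - v.1), (fun x => q.2 x - v.2 x), q.1, q.2, (q.2 q.1).
  split=> //; first exact: is_dualB.
    by rewrite opprB addrC subrK.
  by move=> x; ring.
have Pconv u v a b t : P u a -> P v b -> 0 < t < 1 ->
    P (t *: u + (1 - t) *: v) (t * a + (1 - t) * b).
  move=> [y1 [u1 [k1 [z1 [f1 [r1 [E1 dk1 zu1 fk1 le1]]]]]]].
  move=> [y2 [u2 [k2 [z2 [f2 [r2 [E2 dk2 zu2 fk2 le2]]]]]]] t01.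
  exists (t *: y1 + (1 - t) *: y2), (t *: u1 + (1 - t) *: u2).
  exists (fun x => t * k1 x + (1 - t) * k2 x), (t *: z1 + (1 - t) *: z2).
  exists (fun x => t * f1 x + (1 - t) * f2 x), (t * r1 + (1 - t) * r2).
  split; first exact: fitz_epi_conv.
  - exact: is_dual_conv.
  - by rewrite /= -zu1 -zu2 !scalerBr opprD addrACA.
  - move=> x; rewrite -[RHS]/(t * u.2 x + (1 - t) * v.2 x) -fk1 -fk2; ring.
  - have := G_convex y1 y2 u1 u2 dk1 dk2 t01.
    have /andP[t0 t1] := t01.
    have : t * (r1 + G y1 u1 k1) <= t * a by rewrite ler_wpM2l// ltW.
    have : (1 - t) * (r2 + G y2 u2 k2) <= (1 - t) * b.
      by rewrite ler_wpM2l// subr_ge0 ltW.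
    lra.
have Plow a : P 0 a -> e <= a.
  move=> [y [u [k [z [f [r [E dk zu fk le]]]]]]]; apply: le_trans le.
  have -> : u = z by apply/esym/eqP; rewrite -subr_eq0 zu.
  have -> : k = f.
    apply/funext => x; apply/esym/eqP; rewrite -subr_eq0 fk.
    by apply/eqP.
  exact: lowG.
have [L [Llin Lle]] := convex_affine_minorant D0 Ptot Pconv Plow Dlin.
pose alpha x := L (x, fun=> 0).
pose beta f := L (0, f).
have alphaZD a x y : alpha (a *: x + y) = a * alpha x + alpha y.
  rewrite -Llin//; try exact: is_dual_cst0.
  congr L; congr pair; apply/funext => v; rewrite -[RHS]/(a * 0 + 0); ring.
have betaZD a f g : is_dual f -> is_dual g ->
    beta (fun x => a * f x + g x) = a * beta f + beta g.
  move=> df dg; rewrite -Llin//.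
  by congr L; congr pair; rewrite /= scaler0 addr0.
have Lab x f : is_dual f -> L (x, f) = alpha x + beta f.
  move=> df; have := Llin (x, fun=> 0) (0, f) 1 (@is_dual_cst0 R X) df.
  rewrite mul1r => <-; congr L; congr pair; first by rewrite /= scale1r addr0.
  by apply/funext => v; rewrite -[RHS]/(1 * 0 + f v); ring.
(* Domination at points of [T], regrouped: the left side has the terms of the Fitzpatrick function
   at [(beta, alpha)], and the right side does not depend on [q']. *)
have key y u k q' : is_dual k -> T q' ->
    beta q'.2 + alpha q'.1 - q'.2 q'.1 <= G y u k + alpha u + beta k - e.
  move=> dk Tq'; have dq' := Tg Tq'.
  have := Lle (q'.1 - u, fun x => q'.2 x - k x) (q'.2 q'.1 + G y u k).
  have H1 : D (q'.1 - u, fun x => q'.2 x - k x) by exact: is_dualB.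
  have H2 : P (q'.1 - u, fun x => q'.2 x - k x) (q'.2 q'.1 + G y u k).
    exists y, u, k, q'.1, q'.2, (q'.2 q'.1); split=> //.
    exact: monotone_fitz_epi.
  move=> /(_ H1 H2); rewrite Lab//.
  have -> : q'.1 - u = (-1) *: u + q'.1 by rewrite scaleN1r addrC.
  have -> : (fun x => q'.2 x - k x) = (fun x => -1 * k x + q'.2 x).
    by apply/funext => x; ring.
  by rewrite alphaZD betaZD//; lra.
have alpha0 : alpha 0 = 0.
  by have := alphaZD 1 0 0; rewrite scale1r addr0; lra.
have beta0 : beta (fun=> 0) = 0 by [].
have alphaZ a x : alpha (a *: x) = a * alpha x.
  by have := alphaZD a x 0; rewrite !addr0 alpha0 addr0.
have betaZ a f : is_dual f -> beta (fun x => a * f x) = a * beta f.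
  move=> df; have := betaZD a f _ df (@is_dual_cst0 R X).
  rewrite beta0 addr0 => <-; congr beta; apply/funext => x; ring.
have GE u : G 0 u (fun=> 0) = `|u| ^+ 2 / (2 * l) + G 0 0 (fun=> 0).
  rewrite /G /yosida_energy linear0 !sub0r !oppr0 normr0 !normrN expr0n/=; ring.
(* Along [u = t *: x], with [y] and [k] zero, [key] bounds [- alpha] by a quadratic in [t], which
   gives continuity. The same works for [beta] along [k = t * f]. *)
have dalpha : is_dual alpha.
  pose C := G 0 0 (fun=> 0) + beta (fun=> 0) - e - (beta q.2 + alpha q.1 - q.2 q.1).
  apply: (@bounded_dual _ _ _ (C + (2 * l)^-1)) => [x y|//|x].
    by have := alphaZD 1 x y; rewrite scale1r mul1r.
  rewrite -[`|alpha x|]normrN; apply: quadratic_growth_bound => // t.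
  have := key 0 (t *: x) _ _ (@is_dual_cst0 R X) Tq.
  rewrite /C alphaZ GE normrZ.
  have -> : (2 * l)^-1 * (t * `|x|) ^+ 2 = (`|t| * `|x|) ^+ 2 / (2 * l).
    by rewrite mulrC !exprMn real_normK ?num_real.
  lra.
have bbeta : is_bidual beta.
  split.
    move=> f g df dg; have := betaZD 1 f g df dg; rewrite mul1r => <-.
    by congr beta; apply/funext => x; rewrite mul1r.
  split=> //.
  have [M M0 AM] := continuous_linear_le Ac.
  pose C := G 0 0 (fun=> 0) + `|A x0| ^+ 2 / 2 + dnorm g0 ^+ 2 - e -
    (beta q.2 + alpha q.1 - q.2 q.1).
  exists (C + (l / 2 + 2^-1 + M ^+ 2)) => f df.
  rewrite -[`|beta f|]normrN; apply: quadratic_growth_bound; first exact: dnorm_nneg.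
  move=> t; have dtf := is_dualZ t df.
  have := key 0 0 _ _ dtf Tq; rewrite betaZ// alpha0.
  have n1 : dnorm (fun x => t * f x) <= `|t| * dnorm f by exact: dnormZ_le.
  have n10 := dnorm_nneg dtf.
  set n := dnorm (fun x => t * f x) in n1 n10 *.
  have -> : (t * dnorm f) ^+ 2 = (`|t| * dnorm f) ^+ 2.
    by rewrite !exprMn real_normK ?num_real.
  have n2 : n ^+ 2 <= (`|t| * dnorm f) ^+ 2.
    by rewrite lerXn2r// nnegrE (le_trans n10).
  have n3 : - (t * f (A x0)) <= `|A x0| ^+ 2 / 2 + n ^+ 2 / 2.
    have := dual_ge (A x0) dtf; rewrite -/n.
    have := sqr_ge0 (n - `|A x0|); rewrite sqrrB; lra.
  have n4 : dnorm (fun v => t * f (A v) - g0 v) ^+ 2 / 2 <=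
      M ^+ 2 * n ^+ 2 + dnorm g0 ^+ 2.
    have : dnorm (fun v => t * f (A v) - g0 v) <= M * n + dnorm g0.
      apply: dnorm_le => [|v]; first by rewrite addr_ge0 ?mulr_ge0 ?dnorm_nneg.
      rewrite (le_trans (ler_normB _ _))// mulrDl lerD ?ler_dnorm//.
      by rewrite (le_trans (ler_dnorm _ dtf))// -/n (mulrC M n) -mulrA ler_wpM2l.
    have da : is_dual (fun v => t * f (A v) - g0 v).
      by apply: is_dualB => //; exact: is_dual_comp dtf.
    have := dnorm_nneg da; move: (dnorm _) => m m0 mle.
    have : m ^+ 2 <= (M * n + dnorm g0) ^+ 2.
      by rewrite lerXn2r// nnegrE (le_trans m0).
    have := sqr_ge0 (M * n - dnorm g0); rewrite sqrrB sqrrD exprMn; lra.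
  rewrite /C /G /yosida_energy dnorm_cst0 -/n.
  have n5 : l / 2 * n ^+ 2 <= l / 2 * (`|t| * dnorm f) ^+ 2.
    by rewrite ler_wpM2l// divr_ge0// ltW.
  have n6 : M ^+ 2 * n ^+ 2 <= M ^+ 2 * (`|t| * dnorm f) ^+ 2.
    by rewrite ler_wpM2l// sqr_ge0.
  have := sqr_ge0 (dnorm (fun v : Y => 0 - g0 v)).
  lra.
(* The choice [k = alpha] makes [beta alpha] cancel when (NI) is applied at [(beta, alpha)]. *)
have eG y u : e <= G y u alpha + alpha u.
  have := TN bbeta dalpha (fun q' Tq' => key y u alpha q' dalpha Tq'); lra.
have e2 : 0 < e / 2 by rewrite divr_gt0.
(* At [y = x0 + v] and [u = A y + w] the bound splits into two Young expressions, each made smaller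
   than [e / 2]. *)
have [w hw] := dual_quadratic_inf l0 e2 dalpha.
have da : is_dual (fun v => alpha (A v) - g0 v).
  by apply: is_dualB => //; exact: is_dual_comp.
have [v hv] := dual_quadratic_inf ltr01 e2 da.
have := eG (x0 + v) (A (x0 + v) + w).
rewrite /G /yosida_energy opprD addrA subrr sub0r normrN [x0 + v - _]addrAC subrr add0r.
rewrite (dualD _ _ dalpha) linearD (dualD _ _ dalpha) (dualD _ _ dg0).
lra.
Qed.

End ApproximateMinty.

(** * Geometric sequences and coercivity *)

Section GeometricSequences.
Variable R : realType.

(** The steps [3 * s * 2^-1 ^+ i] from [k] on sum up to [6 * s * 2^-1 ^+ k]. The abstract [d] serves
    both for points and for functionals. *)
Lemma geometric_telescope (d : nat -> nat -> R) (s : R) : 0 <= s ->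
  (forall i, d i i <= 0) -> (forall i j k, d i k <= d i j + d j k) ->
  (forall k, d k k.+1 <= 3 * (s * 2^-1 ^+ k)) ->
  forall k m, (k <= m)%N -> d k m <= 6 * s * 2^-1 ^+ k.
Proof.
move=> s0 d0 dt dS k m /subnKC <-; move: (m - k)%N => j.
have cn n : 0 <= s * 2^-1 ^+ n :> R by rewrite mulr_ge0// exprn_ge0// invr_ge0.
(* Keeping the remaining tail on the right makes the bound inductive. *)
suff : d k (k + j)%N <= 6 * (s * 2^-1 ^+ k) - 6 * (s * 2^-1 ^+ (k + j)).
  by have := cn (k + j)%N; lra.
elim: j => [|j IH]; first by rewrite addn0 subrr.
rewrite addnS; apply: le_trans (dt _ (k + j)%N _) _.
have := dS (k + j)%N; rewrite [2^-1 ^+ (k + j).+1]exprS; lra.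
Qed.

Lemma half_expn_lt (e : R) : 0 < e ->
  exists N, forall n, (N <= n)%N -> 2^-1 ^+ n < e.
Proof.
move=> e0; have h1 : `|2^-1 : R| < 1 by rewrite ger0_norm ?invr_ge0// invf_lt1// ltr1n.
have /cvgrPdist_lt/(_ e e0)[N _ HN] := cvg_expr h1.
exists N => n Nn; have := HN n Nn.
by rewrite /= sub0r normrN ger0_norm// exprn_ge0// invr_ge0.
Qed.

(** Completing squares absorbs the linear terms into half of the quadratic ones; the resulting
    bounds on [a ^+ 2] and [b ^+ 2] enter [M]. *)
Lemma quadratic_coercive (l K p q : R) : 0 < l ->
  exists M, forall a b, a ^+ 2 / (2 * l) + l / 2 * b ^+ 2 <= K + p * a + q * b ->
    a <= M /\ b <= M.
Proof.
move=> l0; pose K' := K + l * p ^+ 2 + q ^+ 2 / l.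
exists (1 + 4 * l * K' + 4 * K' / l) => a b H.
have h1 : 0 <= (a - 2 * l * p) ^+ 2 / (4 * l) by rewrite divr_ge0 ?sqr_ge0//; lra.
have h2 : 0 <= (l * b - 2 * q) ^+ 2 / (4 * l) by rewrite divr_ge0 ?sqr_ge0//; lra.
have h3 : a ^+ 2 / (4 * l) + l / 4 * b ^+ 2 <= K'.
  have e1 : (a - 2 * l * p) ^+ 2 / (4 * l) = a ^+ 2 / (4 * l) - p * a + l * p ^+ 2.
    by field; lra.
  have e2 : (l * b - 2 * q) ^+ 2 / (4 * l) = l / 4 * b ^+ 2 - q * b + q ^+ 2 / l.
    by field; lra.
  have e3 : a ^+ 2 / (2 * l) = 2 * (a ^+ 2 / (4 * l)) by field; lra.
  rewrite e1 in h1; rewrite e2 in h2; rewrite e3 in H; rewrite /K'; lra.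
have a2 : 0 <= a ^+ 2 / (4 * l) by rewrite divr_ge0 ?sqr_ge0//; lra.
have b2 : 0 <= l / 4 * b ^+ 2 by rewrite mulr_ge0 ?sqr_ge0//; lra.
have K0 : 0 <= K' by lra.
have lK : 0 <= 4 * l * K' by rewrite mulr_ge0//; lra.
have Kl : 0 <= 4 * K' / l by rewrite divr_ge0 ?mulr_ge0// ltW.
have aK : a ^+ 2 <= 4 * l * K'.
  have : a ^+ 2 / (4 * l) <= K' by lra.
  by rewrite ler_pdivrMr; lra.
have bK : b ^+ 2 <= 4 * K' / l by rewrite ler_pdivlMr//; lra.
have := sqr_ge0 (a - 1); have := sqr_ge0 (b - 1); rewrite !sqrrB.
split; lra.
Qed.

End GeometricSequences.

(** * Iterating the approximate Minty theorem with decreasing errors *)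

Section MintySequence.
Variables (R : realType) (X Y : normedModType R) (T : op X) (A : {linear Y -> X}).
Hypotheses (Tg : in_graph_space T) (Tm : monotone_op T) (TN : typeNI T).
Hypothesis Ac : continuous A.
Variable l : R.
Hypothesis l0 : 0 < l.

Lemma yosida_gap_ge0 y z f r : fitz_epi T z f r ->
  0 <= r + yosida_energy A l y z f - f (A y).
Proof.
move=> [df H]; have := typeNI_fitzpatrick_ge TN df H.
have := dual_quadratic_ge (z - A y) l0 df.
rewrite (dualB _ _ df) distrC /yosida_energy; lra.
Qed.

(* Two almost exact points have an almost nonnegative duality product: otherwise
   their midpoint would have a negative gap. *)
Lemma yosida_gap_monotone y1 z1 f1 r1 y2 z2 f2 r2 e1 e2 :
  fitz_epi T z1 f1 r1 -> fitz_epi T z2 f2 r2 ->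
  r1 + yosida_energy A l y1 z1 f1 - f1 (A y1) <= e1 ->
  r2 + yosida_energy A l y2 z2 f2 - f2 (A y2) <= e2 ->
  - (2 * (e1 + e2)) <= f2 (A (y2 - y1)) - f1 (A (y2 - y1)).
Proof.
move=> E1 E2 le1 le2; have [d1 _] := E1; have [d2 _] := E2.
have h01 : 0 < (2^-1 : R) < 1 by apply/andP; split; lra.
have Em := fitz_epi_conv Tg h01 E1 E2.
have := yosida_gap_ge0 (2^-1 *: y1 + (1 - 2^-1) *: y2) Em.
have := yosida_energy_convex A y1 y2 z1 z2 l0 d1 d2 h01.
have -> : A (2^-1 *: y1 + (1 - 2^-1) *: y2) = 2^-1 *: A y1 + (1 - 2^-1) *: A y2.
  by rewrite linearD !linearZ.
rewrite linearB (dualB _ _ d1) (dualB _ _ d2).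
rewrite (dualD _ _ d1) (dualD _ _ d2) !(dualZ _ _ d1) !(dualZ _ _ d2); lra.
Qed.

Lemma minty_step y1 z1 f1 r1 e : 0 < e -> fitz_epi T z1 f1 r1 ->
  r1 + yosida_energy A l y1 z1 f1 - f1 (A y1) <= e ^+ 2 ->
  exists y2 z2 f2 r2, [/\ fitz_epi T z2 f2 r2,
    r2 + yosida_energy A l y2 z2 f2 - f2 (A y2) <= (e / 2) ^+ 2,
    `|y2 - y1| <= 3 * e & dnorm (fun v => f2 (A v) - f1 (A v)) <= 3 * e].
Proof.
move=> e0 E1 le1; have [d1 _] := E1; have dA1 := is_dual_comp Ac d1.
have e2 : 0 < (e / 2) ^+ 2 by rewrite exprn_gt0// divr_gt0.
have [y2 [z2 [f2 [r2 [E2 le2]]]]] := approximate_minty Tg Tm TN Ac y1 l0 dA1 e2.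
exists y2, z2, f2, r2; have [d2 _] := E2; have dA2 := is_dual_comp Ac d2.
have dB := is_dualB dA2 dA1; have gap2 := yosida_gap_ge0 y2 E2.
have := dual_quadratic_ge (y2 - y1) ltr01 dB; rewrite /= => q0.
have h2 : r2 + yosida_energy A l y2 z2 f2 - f2 (A y2) <= (e / 2) ^+ 2 by lra.
have := yosida_gap_monotone E1 E2 le1 h2.
have n0 := dnorm_nneg dB.
move: (dnorm _) n0 le2 q0 => n n0 le2 q0 mon.
(* Monotonicity costs at most [2 * (e ^+ 2 + e ^+ 2 / 4)], so both squared distances are at most
   [11 / 2 * e ^+ 2], within the allowed [9 * e ^+ 2]. *)
have e4 : (e / 2) ^+ 2 = e ^+ 2 / 4 by field.
rewrite e4 in le2 mon h2.
split=> //; first by rewrite e4.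
  rewrite -(ler_pXn2r (n := 2))// ?nnegrE//; last by lra.
  by rewrite exprMn; have := sqr_ge0 n; lra.
rewrite -(ler_pXn2r (n := 2))// ?nnegrE//; last by lra.
by rewrite exprMn; have := sqr_ge0 `|y2 - y1|; lra.
Qed.

Lemma minty_sequence y0 z0 f0 r0 s : 0 < s -> fitz_epi T z0 f0 r0 ->
  r0 + yosida_energy A l y0 z0 f0 - f0 (A y0) <= s ^+ 2 ->
  exists (y : nat -> Y) (z : nat -> X) (f : nat -> X -> R) (r : nat -> R),
    [/\ y 0%N = y0 /\ f 0%N = f0,
      forall k, fitz_epi T (z k) (f k) (r k),
      forall k, r k + yosida_energy A l (y k) (z k) (f k) - f k (A (y k)) <=
        (s * 2^-1 ^+ k) ^+ 2,
      forall k, `|y k.+1 - y k| <= 3 * (s * 2^-1 ^+ k) &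
      forall k, dnorm (fun v => f k.+1 (A v) - f k (A v)) <= 3 * (s * 2^-1 ^+ k)].
Proof.
move=> s0 E0 gap0.
(* The index is part of the state so that the invariant can name the tolerance [s * 2^-1 ^+ k]. *)
pose st := (nat * (Y * X * (X -> R) * R))%type.
pose inv (p : st) := let: (k, (y, z, f, r)) := p in fitz_epi T z f r /\
  r + yosida_energy A l y z f - f (A y) <= (s * 2^-1 ^+ k) ^+ 2.
pose next (p q : {p : st | inv p}) :=
  let: (k, (y, z, f, r)) := sval p in let: (k', (y', z', f', r')) := sval q in
  [/\ k' = k.+1, `|y' - y| <= 3 * (s * 2^-1 ^+ k) &
    dnorm (fun v => f' (A v) - f (A v)) <= 3 * (s * 2^-1 ^+ k)].
have nextP p : {q | next p q}.
  apply: cid; case: p => -[k [[[y z] f] r]] [E gap].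
  have sk : 0 < s * 2^-1 ^+ k by rewrite mulr_gt0// exprn_gt0// invr_gt0.
  have [y2 [z2 [f2 [r2 [E2 gap2 dy df]]]]] := minty_step sk E gap.
  have I2 : inv (k.+1, (y2, z2, f2, r2)).
    split=> //; apply: le_trans gap2 _.
    by rewrite [2^-1 ^+ k.+1]exprSr mulrA.
  by exists (exist _ _ I2).
have I0 : inv (0%N, (y0, z0, f0, r0)) by split=> //; rewrite expr0 mulr1.
have [F [F0 FS]] := dependent_choice nextP (exist _ _ I0).
have Fk k : (sval (F k)).1 = k.
  elim: k => [|k]; first by rewrite F0.
  move: (FS k); rewrite /next; case: (F k) => -[k1 [[[y1 z1] f1] r1]] I1 /=.
  by case: (F k.+1) => -[k2 [[[y2 z2] f2] r2]] I2 /= [-> _ _] ->.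
exists (fun k => (sval (F k)).2.1.1.1), (fun k => (sval (F k)).2.1.1.2).
exists (fun k => (sval (F k)).2.1.2), (fun k => (sval (F k)).2.2).
split; first by rewrite F0.
- by move=> k; case: (F k) => -[k1 [[[y1 z1] f1] r1]] [].
- move=> k; move: (Fk k); case: (F k) => -[k1 [[[y1 z1] f1] r1]] [E gap] /= <-.
  exact: gap.
- move=> k; move: (FS k) (Fk k); rewrite /next.
  case: (F k) => -[k1 [[[y1 z1] f1] r1]] I1 /=.
  by case: (F k.+1) => -[k2 [[[y2 z2] f2] r2]] I2 /= [_ ? _] <-.
- move=> k; move: (FS k) (Fk k); rewrite /next.
  case: (F k) => -[k1 [[[y1 z1] f1] r1]] I1 /=.
  by case: (F k.+1) => -[k2 [[[y2 z2] f2] r2]] I2 /= [_ _ ?] <-.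
Qed.

End MintySequence.

(** * Bounded sequences and tangents of the quadratic energy *)

Section BoundedSequences.
Variable R : realType.
Implicit Types u v : nat -> R.

Lemma bounded_seqD u v : bounded_seq u -> bounded_seq v ->
  bounded_seq (fun n => u n + v n).
Proof.
move=> [M uM] [N vN]; exists (M + N) => n.
by rewrite (le_trans (ler_normD _ _))// lerD.
Qed.

Lemma bounded_seqZ a u : bounded_seq u -> bounded_seq (fun n => a * u n).
Proof. by move=> [M uM]; exists (`|a| * M) => n; rewrite normrM ler_wpM2l. Qed.

Lemma bounded_seq_cst a : bounded_seq (fun=> a : R).
Proof. by exists `|a|. Qed.

Lemma young_le (l p q : R) : 0 < l -> p * q <= p ^+ 2 / (2 * l) + l / 2 * q ^+ 2.
Proof.
move=> l0; rewrite -subr_ge0.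
have -> : p ^+ 2 / (2 * l) + l / 2 * q ^+ 2 - p * q = (p - l * q) ^+ 2 / (2 * l).
  by field; lra.
by rewrite divr_ge0 ?sqr_ge0// mulr_ge0// ltW.
Qed.

(** Convexity as a tangent inequality: a generalized limit, being linear and monotone, passes
    through the affine side. *)
Lemma energy_tangent_le (l p q p0 q0 : R) : 0 < l ->
  p0 / l * p + l * q0 * q - (p0 ^+ 2 / (2 * l) + l / 2 * q0 ^+ 2) <=
  p ^+ 2 / (2 * l) + l / 2 * q ^+ 2.
Proof.
move=> l0; rewrite -subr_ge0.
have -> : p ^+ 2 / (2 * l) + l / 2 * q ^+ 2 -
    (p0 / l * p + l * q0 * q - (p0 ^+ 2 / (2 * l) + l / 2 * q0 ^+ 2)) =
  (p - p0) ^+ 2 / (2 * l) + l / 2 * (q - q0) ^+ 2 by field; lra.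
have l1 := ltW l0; apply: addr_ge0; first by rewrite divr_ge0 ?sqr_ge0// mulr_ge0.
by rewrite mulr_ge0 ?sqr_ge0// divr_ge0.
Qed.

Lemma energy_tangent_self (l p q : R) : 0 < l ->
  p / l * p + l * q * q = 2 * (p ^+ 2 / (2 * l) + l / 2 * q ^+ 2).
Proof. by move=> l0; field; lra. Qed.

Lemma energy_scale (l p q : R) : 0 < l ->
  l * (p ^+ 2 / (2 * l) + l / 2 * q ^+ 2) = 2^-1 * p ^+ 2 + 2^-1 * (l * q) ^+ 2.
Proof. by move=> l0; field; lra. Qed.

End BoundedSequences.

(** * Passage to the limit: exact points of the regularization *)

Section ExactPoints.
Variables (R : realType) (X : normedModType R) (Y : completeNormedModType R).
Variables (T : op X) (A : {linear Y -> X}).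
Hypotheses (Tg : in_graph_space T) (Tm : monotone_op T) (TN : typeNI T).
Hypothesis Ac : continuous A.
Variable l : R.
Hypothesis l0 : 0 < l.

(* [a] and [b] stand for the norms of [z - A y] and [f]; the last inequality
   says that [- l f] belongs to the duality mapping of [X**] at [z - A y]. *)
Definition yosida_exact (y : Y) (f : X -> R) := exists (z : (X -> R) -> R) (a b : R),
  [/\ Ttilde T (z, f), 0 <= a /\ 0 <= b,
    forall g, is_dual g -> `|z g - g (A y)| <= a * dnorm g, dnorm f <= b &
    a ^+ 2 / (2 * l) + l / 2 * b ^+ 2 <= f (A y) - z f].

(** Completeness of [Y] gives the limit of the [y k]; generalized limits of [f k x] and [g (z k)]
    define the functional and the bidual point. The constant 6 is the total length of the sequence
    divided by [s]. *)
Lemma yosida_exact_near y0 z0 f0 r0 s : 0 < s -> fitz_epi T z0 f0 r0 ->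
  r0 + yosida_energy A l y0 z0 f0 - f0 (A y0) <= s ^+ 2 ->
  exists y f, [/\ is_dual f, yosida_exact y f, `|y - y0| <= 6 * s &
    dnorm (fun v => f (A v) - f0 (A v)) <= 6 * s].
Proof.
move=> s0 E0 gap0.
have [y [z [f [r [[y0E f0E] E gap dy df]]]]] := minty_sequence Tg Tm TN Ac l0 s0 E0 gap0.
have dual_f k : is_dual (f k) by case: (E k).
have dual_fA k : is_dual (fun v => f k (A v)) by exact: is_dual_comp.
pose c k : R := 2^-1 ^+ k.
have c0 k : 0 <= c k by rewrite exprn_ge0// invr_ge0.
have c1 k : c k <= 1 by rewrite exprn_ile1// ?invr_ge0// invf_le1// ler1n.
have ycauchy k m : (k <= m)%N -> `|y m - y k| <= 6 * s * c k.
  apply: (geometric_telescope (d := fun k m => `|y m - y k|) (ltW s0)) => //.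
  - by move=> i; rewrite subrr normr0.
  - by move=> i j n; rewrite [X in _ <= X]addrC; exact: ler_distD.
have fcauchy k m : (k <= m)%N -> dnorm (fun v => f m (A v) - f k (A v)) <= 6 * s * c k.
  apply: (geometric_telescope
    (d := fun k m => dnorm (fun v => f m (A v) - f k (A v))) (ltW s0)) => //.
  - move=> i; rewrite (_ : (fun v => _) = fun=> 0) ?dnorm_cst0//.
    by apply/funext => v; rewrite subrr.
  - by move=> i j n; rewrite [X in _ <= X]addrC; exact: dnormB_trans.
have /cvg_ex[yl yl_lim] : cvg (y @ \oo).
  apply: cauchy_cvg; apply: cauchy_exP => e e0.
  have e6 : 0 < e / (6 * s) by rewrite divr_gt0// mulr_gt0.
  have [N HN] := half_expn_lt e6.
  exists (y N); exists N => // n /= Nn; rewrite -ball_normE/= distrC.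
  apply: le_lt_trans (ycauchy _ _ Nn) _.
  by rewrite mulrC -ltr_pdivlMr ?mulr_gt0//; exact: HN.
have yl_near k : `|yl - y k| <= 6 * s * c k.
  apply/ler_addgt0Pr => e e0.
  have /cvgrPdist_lt/(_ e e0)[N _ HN] := yl_lim.
  have := HN (maxn k N) (leq_maxr _ _); have := ycauchy _ _ (leq_maxl k N).
  have : `|yl - y k| <= `|yl - y (maxn k N)| + `|y (maxn k N) - y k|.
    by rewrite (le_trans _ (ler_normD _ _))// addrA subrK.
  by rewrite /=; lra.
have [MA MA0 AM] := continuous_linear_le Ac.
have [q Tq] := typeNI_nonempty TN.
have dq := Tg Tq.
have y_bound k : `|y k| <= `|y0| + 6 * s.
  have := ycauchy 0%N k (leq0n _); rewrite /c expr0 mulr1 y0E.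
  have : `|y k| <= `|y0| + `|y k - y0|.
    by rewrite (le_trans _ (ler_normD _ _))// addrC subrK.
  lra.
(* This bound uses the norm of [f k] composed with [A], the norms of the [f k] themselves not being
   controlled yet. *)
pose B := (dnorm (fun v => f0 (A v)) + 6 * s) * (`|y0| + 6 * s).
have fAy_bound k : `|f k (A (y k))| <= B.
  apply: le_trans (ler_dnorm (y k) (dual_fA k)) _.
  apply: ler_pM => //; first exact: dnorm_nneg.
  have := fcauchy 0%N k (leq0n _); rewrite /c expr0 mulr1 f0E.
  have dfA0 : is_dual (fun v => f0 (A v)) by rewrite -f0E.
  have := dnormD_le (is_dualB (dual_fA k) dfA0) dfA0.
  rewrite (_ : (fun x => _ - _ + _) = (fun v => f k (A v))); first by lra.
  by apply/funext => v; rewrite subrK.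
pose a k := `|A (y k) - z k|.
pose b k := dnorm (f k).
have a0 k : 0 <= a k by exact: normr_ge0.
have b0 k : 0 <= b k by exact: dnorm_nneg.
(* Testing the epigraph at the point [q] of [T] bounds [r k] below affinely in [a k] and [b k];
   coercivity of the energy then bounds both. *)
pose K := B + s ^+ 2 + dnorm q.2 * (MA * (`|y0| + 6 * s)) + q.2 q.1.
have z_bound k : `|z k| <= MA * (`|y0| + 6 * s) + a k.
  have : `|z k| <= `|A (y k)| + a k.
    by rewrite /a distrC (le_trans _ (ler_normD _ _))// addrC subrK.
  have := AM (y k).
  have : MA * `|y k| <= MA * (`|y0| + 6 * s) by rewrite ler_wpM2l.
  lra.
have [M HM] := quadratic_coercive K (dnorm q.2) `|q.1| l0.
have ab_bound k : a k <= M /\ b k <= M.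
  apply: HM; have [_ /(_ q Tq)] := E k; have := gap k.
  have : (s * c k) ^+ 2 <= s ^+ 2.
    rewrite exprMn ler_piMr ?sqr_ge0// expr_le1//.
  have := dual_ge (z k) dq; have := dual_ge q.1 (dual_f k).
  have : dnorm q.2 * `|z k| <= dnorm q.2 * (MA * (`|y0| + 6 * s) + a k).
    by rewrite ler_wpM2l// dnorm_nneg.
  have := le_trans (ler_norm _) (fAy_bound k).
  by rewrite /yosida_energy /K /a /b /c; lra.
have ba : bounded_seq a by exists M => k; rewrite (ger0_norm (a0 k)); case: (ab_bound k).
have bb : bounded_seq b by exists M => k; rewrite (ger0_norm (b0 k)); case: (ab_bound k).
have M0 : 0 <= M by apply: le_trans (ab_bound 0%N).2.
have bf x : bounded_seq (fun k => f k x).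
  exists (M * `|x|) => k; rewrite (le_trans (ler_dnorm _ (dual_f k)))//.
  by rewrite ler_wpM2r//; case: (ab_bound k).
have bz g : is_dual g -> bounded_seq (fun k => g (z k)).
  move=> dg; exists (dnorm g * (MA * (`|y0| + 6 * s) + M)) => k.
  rewrite (le_trans (ler_dnorm _ dg))// ler_wpM2l ?dnorm_nneg//.
  by rewrite (le_trans (z_bound k))// lerD2l; case: (ab_bound k).
have br : bounded_seq r.
  exists (B + s ^+ 2 + M * (MA * (`|y0| + 6 * s) + M)) => k.
  have h1 : - (M * (MA * (`|y0| + 6 * s) + M)) <= r k.
    have [dfk Hk] := E k; have := typeNI_fitzpatrick_ge TN dfk Hk.
    have := dual_ge (z k) dfk.
    have : dnorm (f k) * `|z k| <= M * (MA * (`|y0| + 6 * s) + M).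
      apply: ler_pM => //; first exact: dnorm_nneg.
        by case: (ab_bound k).
      by rewrite (le_trans (z_bound k))// lerD2l; case: (ab_bound k).
    lra.
  have h2 : r k <= B + s ^+ 2.
    have := gap k; have := le_trans (ler_norm _) (fAy_bound k).
    have : (s * c k) ^+ 2 <= s ^+ 2.
      by rewrite exprMn ler_piMr ?sqr_ge0// expr_le1.
    have : 0 <= yosida_energy A l (y k) (z k) (f k).
      rewrite /yosida_energy addr_ge0//.
        by rewrite divr_ge0 ?sqr_ge0// mulr_ge0// ltW.
      by rewrite mulr_ge0 ?sqr_ge0// divr_ge0// ltW.
    rewrite /c; lra.
  have B0 : 0 <= B by exact: le_trans (fAy_bound 0%N).
  have zM : 0 <= MA * (`|y0| + 6 * s) + M.
    by rewrite addr_ge0// mulr_ge0// addr_ge0// mulr_ge0// ltW.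
  have MM : 0 <= M * (MA * (`|y0| + 6 * s) + M) by rewrite mulr_ge0.
  by rewrite ler_norml; apply/andP; split; have := sqr_ge0 s; lra.
have bc : bounded_seq c by exists 1 => k; rewrite (ger0_norm (c0 k)).
have [LIM [LD LZ LC Lle]] := generalized_limit R.
have Labs u v : bounded_seq u -> bounded_seq v -> (forall k, `|u k| <= v k) ->
    `|LIM u| <= LIM v.
  move=> bu bv uv; rewrite ler_norml -[- LIM v]mulN1r -LZ//.
  apply/andP; split; apply: (Lle _ _ 0%N) => //; try exact: bounded_seqZ.
    by move=> k _; have := uv k; rewrite ler_norml mulN1r => /andP[].
  by move=> k _; have := uv k; rewrite ler_norml => /andP[].
have Llin u v w x t : bounded_seq u -> bounded_seq v -> bounded_seq w ->
    LIM (fun k => u k + x * v k + t * w k) = LIM u + x * LIM v + t * LIM w.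
  move=> bu bv bw; have bxv := bounded_seqZ x bv; have btw := bounded_seqZ t bw.
  by rewrite (LD _ _ (bounded_seqD bu bxv) btw) LD// !LZ.
have Lc : LIM c = 0.
  apply/eqP; rewrite eq_le; apply/andP; split; last first.
    by rewrite -(LC 0); apply: (Lle _ _ 0%N) => //; exact: bounded_seq_cst.
  apply/ler_addgt0Pr => e e0; rewrite add0r -(LC e).
  have [N HN] := half_expn_lt e0.
  apply: (Lle _ _ N) => //; first exact: bounded_seq_cst.
  by move=> k /HN/ltW.
pose fl x := LIM (fun k => f k x).
pose zl (g : X -> R) := LIM (fun k => g (z k)).
pose al := LIM a; pose bl := LIM b; pose rho := LIM r.
have al0 : 0 <= al.
  by rewrite -(LC 0); apply: (Lle _ _ 0%N) => //; exact: bounded_seq_cst.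
have bl0 : 0 <= bl.
  by rewrite -(LC 0); apply: (Lle _ _ 0%N) => //; exact: bounded_seq_cst.
have fl_le x : `|fl x| <= bl * `|x|.
  rewrite mulrC -LZ//; apply: Labs => //; first exact: bounded_seqZ.
  by move=> k; rewrite mulrC; exact: ler_dnorm.
have dfl : is_dual fl.
  apply: bounded_dual fl_le => [u v|t u].
    by rewrite -LD//; congr LIM; apply/funext => k; exact: dualD.
  by rewrite -LZ//; congr LIM; apply/funext => k; exact: dualZ.
have zl_le g : is_dual g -> `|zl g - g (A yl)| <= al * dnorm g.
  move=> dg.
  have -> : zl g - g (A yl) = LIM (fun k => g (z k) + - g (A yl)).
    by rewrite LD// ?LC//; [exact: bz|exact: bounded_seq_cst].
  have -> : al * dnorm g = LIM (fun k => dnorm g * a k + dnorm g * (MA * 6 * s) * c k).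
    rewrite LD//; try exact: bounded_seqZ.
    by rewrite !LZ// Lc mulr0 addr0 mulrC.
  apply: Labs.
  - by apply: bounded_seqD; [exact: bz|exact: bounded_seq_cst].
  - by apply: bounded_seqD; exact: bounded_seqZ.
  - move=> k; rewrite -(dualB _ _ dg) (le_trans (ler_dnorm _ dg))//.
    rewrite -mulrA -mulrDr ler_wpM2l ?dnorm_nneg//.
    have : `|z k - A yl| <= `|z k - A (y k)| + `|A (y k) - A yl|.
      by rewrite (le_trans _ (ler_normD _ _))// addrA subrK.
    have := AM (yl - y k); rewrite linearB distrC.
    have : MA * `|yl - y k| <= MA * (6 * s * c k) by rewrite ler_wpM2l.
    rewrite /a (distrC (A (y k)) (z k)); lra.
have bzl : is_bidual zl.
  split.
    by move=> g h dg dh; rewrite -LD//; exact: bz.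
  split.
    by move=> t g dg; rewrite -LZ//; exact: bz.
  exists (al + `|A yl|) => g dg; rewrite mulrDl.
  have := zl_le g dg; have := ler_dnorm (A yl) dg.
  have : `|zl g| <= `|zl g - g (A yl)| + `|g (A yl)|.
    by rewrite (le_trans _ (ler_normD _ _))// subrK.
  lra.
have fitz p : T p -> zl p.2 + fl p.1 - p.2 p.1 <= rho.
  move=> Tp; have dp := Tg Tp.
  have -> : zl p.2 + fl p.1 - p.2 p.1 =
      LIM (fun k => p.2 (z k) + f k p.1 + - p.2 p.1).
    rewrite LD ?LC//; last exact: bounded_seq_cst.
      by rewrite LD//; exact: bz.
    by apply: bounded_seqD => //; exact: bz.
  apply: (Lle _ _ 0%N) => //.
    by apply: bounded_seqD (bounded_seq_cst _); apply: bounded_seqD => //; exact: bz.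
  by move=> k _; case: (E k) => _; apply.
have NIl := TN bzl dfl fitz.
(* The squares are replaced by their tangent at [(al, bl)], whose limit value is the energy at
   [(al, bl)]. The constant is written [K3 * 1] to fit [Llin]. *)
have limit_gap : rho + al ^+ 2 / (2 * l) + l / 2 * bl ^+ 2 <= fl (A yl).
  pose K2 := M * (MA * 6 * s) + s ^+ 2.
  pose K3 := al ^+ 2 / (2 * l) + l / 2 * bl ^+ 2.
  have b1 := bounded_seq_cst (1 : R).
  have : LIM (fun k => r k + al / l * a k + l * bl * b k) <=
      LIM (fun k => f k (A yl) + K2 * c k + K3 * 1).
    apply: (Lle _ _ 0%N).
    - apply: bounded_seqD (bounded_seqZ _ _) => //.
      by apply: bounded_seqD (bounded_seqZ _ _).
    - apply: bounded_seqD (bounded_seqZ _ _) => //.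
      by apply: bounded_seqD (bounded_seqZ _ _).
    move=> k _.
    have h1 : f k (A (y k)) <= f k (A yl) + M * (MA * 6 * s) * c k.
      have -> : A (y k) = A yl - A (yl - y k) by rewrite linearB opprB addrC subrK.
      rewrite (dualB _ _ (dual_f k)).
      have := dual_ge (A (yl - y k)) (dual_f k).
      have : dnorm (f k) * `|A (yl - y k)| <= M * (MA * (6 * s * c k)).
        apply: ler_pM => //; first exact: dnorm_nneg.
          by case: (ab_bound k).
        by rewrite (le_trans (AM _))// ler_wpM2l.
      lra.
    have h2 : (s * c k) ^+ 2 <= s ^+ 2 * c k.
      by rewrite exprMn ler_wpM2l ?sqr_ge0// expr2 ler_piMr.
    have h3 := energy_tangent_le (a k) (b k) al bl l0.
    by have := gap k; rewrite /yosida_energy -/(a k) -/(b k) -/(c k) /K2 /K3; lra.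
  rewrite !Llin// Lc LC -/al -/bl -/rho -/(fl _) /K3.
  by have := energy_tangent_self al bl l0; lra.
have fl_bl : dnorm fl <= bl by exact: dnorm_le.
(* With [limit_gap] this gives [rho <= zl fl], hence membership in [Ttilde T]; the converse
   inequality [NIl] turns [limit_gap] into the last clause of [yosida_exact]. *)
have zfl : fl (A yl) - zl fl <= al ^+ 2 / (2 * l) + l / 2 * bl ^+ 2.
  have := zl_le fl dfl; rewrite ler_norml => /andP[h1 _].
  have h2 : al * dnorm fl <= al * bl by rewrite ler_wpM2l.
  by have := young_le al bl l0; lra.
exists yl, fl; split=> //.
- exists zl, al, bl; split=> //; last by lra.
  apply/Ttilde_fitzpatrick => //; split=> // p /fitz; lra.
- by have := yl_near 0%N; rewrite y0E /c expr0 mulr1.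
- apply: dnorm_le => [|v]; first by rewrite mulr_ge0// ltW.
  have -> : fl (A v) - f0 (A v) = LIM (fun k => f k (A v) + - f0 (A v)).
    by rewrite LD// ?LC//; exact: bounded_seq_cst.
  rewrite -[X in _ <= X]LC; apply: Labs.
  - by apply: bounded_seqD => //; exact: bounded_seq_cst.
  - exact: bounded_seq_cst.
  - move=> k; have := fcauchy 0%N k (leq0n _); rewrite f0E /c expr0 mulr1 => h.
    have dB : is_dual (fun v => f k (A v) - f0 (A v)).
      by rewrite -f0E; exact: is_dualB.
    by rewrite (le_trans (ler_dnorm v dB))// ler_wpM2r.
Qed.

End ExactPoints.

(** * The duality mapping: dense range and type (NI) *)

Section DualityMapping.
Variable R : realType.

(** An affine minorant of the norm translated by [x], with value [|x|] at 0; evaluating it at [- x]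
    shows that it norms [x]. *)
Lemma norming_functional (X : normedModType R) (x : X) :
  exists2 f : X -> R, is_dual f & dnorm f <= 1 /\ f x = `|x|.
Proof.
pose P (v : X) (a : R) : Prop := `|x + v| <= a.
have [//|v _|u v a b t|a|//|L [Llin Lle]] :=
    @convex_affine_minorant R X setT P `|x|.
- by exists `|x + v|; rewrite /P.
- rewrite /P => ua vb t01; have /andP[t0 t1] := t01.
  have -> : x + (t *: u + (1 - t) *: v) = t *: (x + u) + (1 - t) *: (x + v).
    by rewrite !scalerDr addrACA -scalerDl subrKC scale1r.
  rewrite (le_trans (norm_conv_le _ _ t01))//.
  by rewrite lerD// ler_wpM2l ?subr_ge0// ltW.
- by rewrite /P addr0.
have L0 : L 0 = 0 by have := Llin 0 0 1 I I; rewrite scale1r addr0; lra.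
have LZ a u : L (a *: u) = a * L u by have := Llin u 0 a I I; rewrite !addr0 L0 addr0.
have Lx v : L v <= `|v|.
  have := Lle v `|x + v| I (lexx _); have := ler_normD x v; lra.
have LN v : - L v <= `|v| by rewrite -mulN1r -LZ scaleN1r -normrN; exact: Lx.
have Lb v : `|L v| <= 1 * `|v|.
  by rewrite mul1r ler_norml; apply/andP; split=> //; have := LN v; lra.
have dL : is_dual L.
  by apply: bounded_dual Lb => // u v; have := Llin u v 1 I I; rewrite scale1r mul1r.
exists L => //; split; first exact: dnorm_le Lb.
have := Lle (- x) `|x + - x| I (lexx _); rewrite subrr normr0 (dualN _ dL).
have := Lx x; lra.
Qed.

Lemma ler_norm_dual (X : normedModType R) (x : X) a : 0 <= a ->
  (forall f, is_dual f -> `|f x| <= a * dnorm f) -> `|x| <= a.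
Proof.
move=> a0 H; have [f df [f1 fx]] := norming_functional x.
have := H f df; rewrite fx normr_id => /le_trans; apply.
by rewrite ler_piMr.
Qed.

(** The subgradient inequality is tested at a point where Young's inequality for [g] is almost an
    equality. *)
Lemma Jmap_energy (X : normedModType R) (w : X) g : Jmap (w, g) ->
  2^-1 * `|w| ^+ 2 + 2^-1 * dnorm g ^+ 2 <= g w.
Proof.
move=> [/= dg H]; apply/ler_addgt0Pr => e e0.
have [x hx] := dual_quadratic_inf ltr01 e0 dg.
have := H (- x); rewrite (dualB _ _ dg) (dualN _ dg) normrN; lra.
Qed.

Lemma Jmap_in_graph (X : normedModType R) : in_graph_space (@Jmap R X).
Proof. by move=> p []. Qed.

(* The duality mapping is the Yosida regularization of index 1 of the normal
   cone to [0], so that the density of its range (the Bishop-Phelps theorem) is an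
   instance of [yosida_exact_near]. *)
Lemma Jmap_dense_range (X : completeNormedModType R) (f : X -> R) s : 0 < s ->
  is_dual f -> exists w g, [/\ Jmap (w, g), dnorm (fun v => g v - f v) <= 6 * s &
    `|w| <= dnorm f + 8 * s].
Proof.
move=> s0 df; pose T : op X := [set p | p.1 = 0 /\ is_dual p.2].
have Tg : in_graph_space T by move=> p [].
have Tm : monotone_op T.
  move=> p q [p1 dp] [q1 dq]; have -> : p.1 - q.1 = 0 by rewrite p1 q1 subrr.
  by rewrite (dual0 dp) (dual0 dq) subrr.
have TN : typeNI T.
  move=> z g rho bz dg H; have := H (0, g) (conj erefl dg) => /=.
  by rewrite addrK.
pose A : {linear X -> X} := idfun.
have Ac : continuous A by move=> x; exact: cvg_id.
have s2 : 0 < s ^+ 2 by rewrite exprn_gt0.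
have [x hx] := dual_quadratic_inf ltr01 s2 (is_dualN df).
have nN : dnorm (fun x => - f x) = dnorm f.
  by rewrite /dnorm; congr sup; apply/seteqP; split=> _ [v v1 <-]; exists v => //;
    rewrite normrN.
rewrite nN in hx.
have E0 : fitz_epi T 0 f 0.
  by split=> // q [q1 dq]; rewrite q1 !(dual0 dq) (dual0 df); lra.
have gap0 : 0 + yosida_energy A 1 x 0 f - f (A x) <= s ^+ 2.
  by rewrite /yosida_energy/= subr0; lra.
have [w [g [dg [z [a [b [Tz [a0 b0] zA gb ab]]]] wx gf]]] :=
  yosida_exact_near Tg Tm TN Ac ltr01 s0 E0 gap0.
have [bz _ Hz] := (Ttilde_fitzpatrick z g Tg).1 Tz.
(* The graph contains every dual functional over 0, so a nonzero [z h] could be scaled past the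
   Fitzpatrick bound. *)
have z0 h : is_dual h -> z h = 0.
  move=> dh; have [_ [zZ _]] := bz; apply: contrapT => /eqP zh.
  have := Hz (0, fun v => (z g + 1) / z h * h v) (conj erefl (is_dualZ _ dh)).
  by rewrite /= zZ// divfK// (dual0 dg) (dual0 dh); lra.
have wa : `|w| <= a.
  by apply: ler_norm_dual => // h dh; have := zA h dh; rewrite z0// sub0r normrN.
exists w, g; split=> //.
  split=> //= v; rewrite (dualB _ _ dg).
  have := dual_le v dg.
  have : dnorm g * `|v| <= b * `|v| by rewrite ler_wpM2r.
  have := young_le b `|v| ltr01.
  have : `|w| ^+ 2 <= a ^+ 2 by rewrite lerXn2r// nnegrE.
  by move: ab; rewrite z0//=; lra.
have : `|w| <= `|x| + `|w - x| by rewrite (le_trans _ (ler_normD _ _))// addrC subrK.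
(* The choice of [x] makes the square of this difference at most [2 * s ^+ 2]; the other [6 * s]
   comes from the distance of [w] to [x]. *)
suff : `|x| - dnorm f <= 2 * s by lra.
have := dual_le x df; have := sqr_ge0 (`|x| - dnorm f) => h1 h2.
have h3 : (`|x| - dnorm f) ^+ 2 <= (2 * s) ^+ 2.
  by rewrite exprMn; move: h2 hx; rewrite sqrrB; have := sqr_ge0 s; lra.
rewrite leNgt; apply/negP => h4.
have : (2 * s) ^+ 2 < (`|x| - dnorm f) ^+ 2.
  by rewrite ltrXn2r// ?nnegrE//; lra.
by rewrite ltNge h3.
Qed.

(** Density of the range lets [f] be replaced by a value [g] of the duality mapping at [w], for
    which the hypothesis bounds [z g + f w - g w]; the error is small because [w] stays bounded. *)
Lemma Jmap_typeNI (X : completeNormedModType R) : typeNI (@Jmap R X).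
Proof.
move=> z f rho bz df H; apply/ler_addgt0Pr => e e0.
have [C C0 zC] := bidual_le bz.
have n0 := dnorm_nneg df.
pose K := 6 * (dnorm f + 8 + C).
have K0 : 0 < K by rewrite /K; lra.
have s0 : 0 < e / (K + e) by rewrite divr_gt0// addr_gt0.
have s1 : e / (K + e) <= 1 by rewrite ler_pdivrMr ?addr_gt0// mul1r lerDr ltW.
have sK : e / (K + e) * K <= e.
  by rewrite mulrAC ler_pdivrMr ?addr_gt0// ler_wpM2l ?lerDl//; exact: ltW.
move: (e / (K + e)) s0 s1 sK => s s0 s1 sK.
have [w [g [Jwg gf wf]]] := Jmap_dense_range s0 df.
have dg : is_dual g by case: Jwg.
have := H _ Jwg; rewrite /= => h1.
have dB := is_dualB df dg.
have := le_trans (ler_norm _) (zC _ dB); rewrite bidualB//.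
have := dual_ge w dB; rewrite /= [dnorm _]dnormBC.
set n := dnorm _ in gf *; rewrite -/n.
have n6 : n * `|w| <= 6 * s * (dnorm f + 8).
  apply: ler_pM => //; first by rewrite /n dnorm_nneg//; exact: is_dualB.
  by apply: le_trans wf _; lra.
have n7 : C * n <= C * (6 * s) by rewrite ler_wpM2l.
rewrite /K in sK; lra.
Qed.

End DualityMapping.

(** * Monotonicity and exact points of the Yosida regularization *)

Section YosidaRegularization.
Variables (R : realType) (X : completeNormedModType R) (T : op X).
Hypotheses (Tg : in_graph_space T) (TN : typeNI T).
Variable l : R.
Hypothesis l0 : 0 < l.

Lemma yosida_in_graph : in_graph_space (yosida T l).
Proof. by move=> p [z [_ [[_ [dp _]] _]]]. Qed.

(** [l] times the duality product of two points is the sum of [l] times the product for [Ttilde T]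
    and the product for the extended duality mapping, both nonnegative by (NI). *)
Lemma yosida_monotone : monotone_op (yosida T l).
Proof.
move=> [x1 f1] [x2 f2] [z1 [bz1 [T1 J1]]] [z2 [bz2 [T2 J2]]] /=.
have d1 : is_dual f1 by case: T1 => _ [].
have d2 : is_dual f2 by case: T2 => _ [].
have := typeNI_Ttilde_monotone Tg TN T1 T2.
have := typeNI_Ttilde_monotone (@Jmap_in_graph R X) (@Jmap_typeNI R X) J1 J2.
have zE z f : is_bidual z -> is_dual f -> z (fun x => - (l * f x)) = - (l * z f).
  move=> [_ [zZ _]] df; rewrite -mulNr -zZ//.
  by congr z; apply/funext => x; rewrite mulNr.
rewrite /= !zE// (dualB _ _ d1) (dualB _ _ d2) => hJ hT.
rewrite -(pmulr_rge0 _ l0).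
have : 0 <= l * (z1 f1 - z1 f2 - z2 f1 + z2 f2) by rewrite mulr_ge0// ltW.
lra.
Qed.

Lemma yosida_exact_yosida (Y : completeNormedModType R) (A : {linear Y -> X}) y f :
  yosida_exact T A l y f -> yosida T l (A y, f).
Proof.
move=> [z [a [b [Tz [a0 b0] zA fb ab]]]].
have [bz [df _]] := Tz; rewrite /= in bz df.
exists z; split=> //; split=> //=.
have [zD [zZ _]] := bz.
have dx : is_dual (fun x => - (l * f x)) by exact/is_dualN/is_dualZ.
have bzeta : is_bidual (fun g => z g - g (A y)).
  split; first by move=> g h dg dh; rewrite zD//; ring.
  split; first by move=> t g dg; rewrite zZ//; ring.
  by exists a.
apply/Ttilde_fitzpatrick; first exact: Jmap_in_graph.
split=> // -[w g] Jwg; have [/= dg _] := Jwg; rewrite /=.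
have -> : z (fun x => - (l * f x)) = - (l * z f).
  rewrite -mulNr -zZ//; congr z; apply/funext => x; exact/esym/mulNr.
have h1 := Jmap_energy Jwg.
have h2 := le_trans (ler_norm _) (zA g dg).
have h3 : - (l * f w) <= l * b * `|w|.
  rewrite -mulrN -mulrA; apply: ler_wpM2l; first exact: ltW.
  have := dual_ge w df; have : dnorm f * `|w| <= b * `|w| by rewrite ler_wpM2r.
  lra.
have h4 : 2^-1 * a ^+ 2 + 2^-1 * (l * b) ^+ 2 <= l * (f (A y) - z f).
  by have := ab; rewrite -(ler_pM2l l0) energy_scale.
have := sqr_ge0 (a - dnorm g); have := sqr_ge0 (l * b - `|w|).
rewrite !sqrrB; lra.
Qed.

End YosidaRegularization.

(** * Quantitative Minty property of the composed operators *)

Section ComposedYosida.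
Variables (R : realType) (X Y : completeNormedModType R).
Variables (T : op X) (A : {linear Y -> X}).
Hypotheses (Tg : in_graph_space T) (Tm : monotone_op T) (TN : typeNI T).
Hypothesis Ac : continuous A.
Variable l : R.
Hypothesis l0 : 0 < l.

Let S := compose_op A (yosida T l).

Lemma compose_yosida_in_graph : in_graph_space S.
Proof.
move=> [y g] [f [/yosida_in_graph/= df /= ->]]; exact: is_dual_comp.
Qed.

Lemma compose_yosida_monotone : monotone_op S.
Proof.
move=> [y1 g1] [y2 g2] [f1 [S1 /= ->]] [f2 [S2 /= ->]].
by have := yosida_monotone Tg TN l0 S1 S2; rewrite /= linearB.
Qed.

(** An approximate Minty point with error [s ^+ 2] is moved by at most [6 * s] to an exact one. The
    first bound will show that Fitzpatrick functions majorize the duality product, the second that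
    near equality forces proximity to the graph. *)
Lemma compose_yosida_minty x0 g0 s : 0 < s -> is_dual g0 ->
  exists q, [/\ S q, q.2 (q.1 - x0) - g0 (q.1 - x0) <= 73 * s ^+ 2 &
    - s ^+ 2 <= q.2 (q.1 - x0) - g0 (q.1 - x0) ->
    `|q.1 - x0| <= 27 * s /\ dnorm (fun v => q.2 v - g0 v) <= 27 * s].
Proof.
move=> s0 dg0; have s2 : 0 < s ^+ 2 by rewrite exprn_gt0.
have [y [z [f [r [E le]]]]] := approximate_minty Tg Tm TN Ac x0 l0 dg0 s2.
have [df _] := E; have dfA := is_dual_comp Ac df; have dB := is_dualB dfA dg0.
have gap := yosida_gap_ge0 A TN l0 y E.
have br := dual_quadratic_ge (y - x0) ltr01 dB; rewrite /= in br.
have gap_le : r + yosida_energy A l y z f - f (A y) <= s ^+ 2 by lra.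
have [y' [f' [df' ex yy ff]]] := yosida_exact_near Tg Tm TN Ac l0 s0 E gap_le.
have dfA' := is_dual_comp Ac df'; have dB' := is_dualB dfA' dfA.
exists (y', fun v => f' (A v)); rewrite /=.
have u0 : 0 <= `|y - x0| by [].
have n0 := dnorm_nneg dB.
have m0 := dnorm_nneg dB'.
have e1 : f' (A (y' - x0)) - g0 (y' - x0) = f (A (y - x0)) - g0 (y - x0) +
    (f' (A (y - x0)) - f (A (y - x0))) + (f' (A (y' - y)) - f (A (y' - y))) +
    (f (A (y' - y)) - g0 (y' - y)).
  rewrite !linearB !(dualB _ _ df) !(dualB _ _ df') !(dualB _ _ dg0); ring.
have h1 := dual_le (y - x0) dB'.
have h2 := dual_le (y' - y) dB'.
have h3 := dual_le (y' - y) dB.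
have tri : `|y' - x0| <= `|y' - y| + `|y - x0| by exact: ler_distD.
have trn := dnormB_trans dfA' dfA dg0.
rewrite /= in h1 h2 h3 e1.
move: (dnorm (fun v => f' (A v) - f (A v))) (dnorm (fun v => f (A v) - g0 v))
  `|y - x0| `|y' - y| m0 n0 u0 h1 h2 h3 br le yy ff tri trn (normr_ge0 (y' - y))
  => m n u t m0 n0 u0 h1 h2 h3 br le tl ml tri trn t0.
have k1 : m * u <= 6 * s * u by rewrite ler_wpM2r.
have k2 : m * t <= 6 * s * (6 * s) by exact: ler_pM.
have k3 : n * t <= n * (6 * s) by rewrite ler_wpM2l.
(* The right side is largest at [u = n = 6 * s], with value [73 * s ^+ 2]. The lower bound
   [- s ^+ 2] forces [u] and [n] below [21 * s], and the move adds [6 * s]. *)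
have bound : f' (A (y' - x0)) - g0 (y' - x0) <=
    s ^+ 2 - u ^+ 2 / 2 - n ^+ 2 / 2 + 6 * s * u + 36 * s ^+ 2 + 6 * s * n.
  by rewrite e1; lra.
split.
- by exists f'; split=> //; exact: yosida_exact_yosida.
- have := sqr_ge0 (u - 6 * s); have := sqr_ge0 (n - 6 * s); rewrite !sqrrB !exprMn; lra.
- move=> low.
  have k4 : u ^+ 2 + n ^+ 2 <= (21 * s) ^+ 2.
    have := sqr_ge0 (u - 12 * s); have := sqr_ge0 (n - 12 * s).
    rewrite !sqrrB !exprMn; lra.
  have uu : u <= 21 * s.
    rewrite -(ler_pXn2r (n := 2))// ?nnegrE//; last by lra.
    by have := sqr_ge0 n; lra.
  have nn : n <= 21 * s.
    rewrite -(ler_pXn2r (n := 2))// ?nnegrE//; last by lra.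
    by have := sqr_ge0 u; lra.
  by split; lra.
Qed.

End ComposedYosida.

(** * Representability from closed convex epigraphs *)

Section Representability.
Variables (R : realType) (Y : normedModType R).
Implicit Types (p q : Y * (Y -> R)) (Q : Y * (Y -> R) -> R -> Prop).

Definition pair_near p q (e : R) :=
  `|q.1 - p.1| < e /\ dnorm (fun y => q.2 y - p.2 y) < e.

Definition pair_conv (t : R) p q : Y * (Y -> R) :=
  (t *: p.1 + (1 - t) *: q.1, fun y => t * p.2 y + (1 - t) * q.2 y).

Lemma pair_near_trans p q o d e : is_dual p.2 -> is_dual q.2 -> is_dual o.2 ->
  pair_near p q d -> pair_near q o e -> pair_near p o (d + e).
Proof.
move=> dp dq d_o [pq1 pq2] [qo1 qo2]; split.
  by have := ler_distD q.1 o.1 p.1; lra.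
by have := dnormB_trans d_o dq dp; lra.
Qed.

Lemma pair_near_conv t p q p' q' e : 0 < t < 1 ->
  is_dual p.2 -> is_dual q.2 -> is_dual p'.2 -> is_dual q'.2 ->
  pair_near p p' e -> pair_near q q' e ->
  pair_near (pair_conv t p q) (pair_conv t p' q') e.
Proof.
move=> t01 dp dq dp' dq' [p1 p2] [q1 q2]; have /andP[t0 t1] := t01.
have lt_conv a b : a < e -> b < e -> t * a + (1 - t) * b < e.
  move=> ae be; have -> : e = t * e + (1 - t) * e by ring.
  by rewrite ltrD// ltr_pM2l// subr_gt0.
split; rewrite /pair_conv/=.
  have -> : t *: p'.1 + (1 - t) *: q'.1 - (t *: p.1 + (1 - t) *: q.1) =
      t *: (p'.1 - p.1) + (1 - t) *: (q'.1 - q.1).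
    by rewrite !scalerBr opprD addrACA.
  by rewrite (le_lt_trans (norm_conv_le _ _ t01))// lt_conv.
have -> : (fun y => t * p'.2 y + (1 - t) * q'.2 y - (t * p.2 y + (1 - t) * q.2 y)) =
    (fun y => t * (p'.2 y - p.2 y) + (1 - t) * (q'.2 y - q.2 y)).
  by apply/funext => y; ring.
have dd := dnorm_conv_le (is_dualB dp' dp) (is_dualB dq' dq) t01.
by rewrite (le_lt_trans dd)// lt_conv.
Qed.

Lemma pairing_near_le p q d : is_dual p.2 -> is_dual q.2 -> d <= 1 ->
  pair_near p q d -> `|q.2 q.1 - p.2 p.1| <= d * (`|p.1| + dnorm p.2 + 1).
Proof.
move=> dp dq d1 [pq1 pq2]; have dB := is_dualB dq dp.
have -> : q.2 q.1 - p.2 p.1 = (q.2 q.1 - p.2 q.1) + p.2 (q.1 - p.1).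
  by rewrite (dualB _ _ dp); ring.
have d0 : 0 <= d by rewrite (le_trans _ (ltW pq1)).
have q1 : `|q.1| <= `|p.1| + 1.
  have : `|q.1| <= `|p.1| + `|q.1 - p.1|.
    by rewrite (le_trans _ (ler_normD _ _))// addrC subrK.
  lra.
have h1 := ler_dnorm q.1 dB; have h2 := ler_dnorm (q.1 - p.1) dp.
have h3 : dnorm (fun y => q.2 y - p.2 y) * `|q.1| <= d * (`|p.1| + 1).
  by apply: ler_pM => //; [exact: dnorm_nneg|exact: ltW].
have h4 : dnorm p.2 * `|q.1 - p.1| <= dnorm p.2 * d.
  by rewrite ler_wpM2l ?dnorm_nneg//; exact: ltW.
by have := ler_normD (q.2 q.1 - p.2 q.1) (p.2 (q.1 - p.1)); rewrite /= in h1; lra.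
Qed.

Lemma small_radius (e K : R) : 0 < e -> 0 <= K ->
  exists d, [/\ 0 < d, d <= 1, d <= e & d * K <= e].
Proof.
move=> e0 K0; have c0 : 0 < K + 1 + e by lra.
exists (e / (K + 1 + e)); split; first exact: divr_gt0.
- by rewrite ler_pdivrMr//; lra.
- by rewrite ler_pdivrMr// ler_peMr//; lra.
- by rewrite mulrAC ler_pdivrMr// ler_wpM2l//; lra.
Qed.

(** The representing function is the infimum of the sections of [Q]. Closedness gives lower
    semicontinuity and, applied with [q = p], attainment of the infimum. *)
Lemma representable_epigraph Q :
  (forall p q a b t, Q p a -> Q q b -> 0 < t < 1 ->
    Q (pair_conv t p q) (t * a + (1 - t) * b)) ->
  (forall p r, is_dual p.2 -> (forall e, 0 < e -> exists q rho,
      [/\ is_dual q.2, pair_near p q e, rho <= r + e & Q q rho]) -> Q p r) ->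
  (forall p r, Q p r -> p.2 p.1 <= r) ->
  (exists p r, is_dual p.2 /\ Q p r) ->
  representable [set p | is_dual p.2 /\ Q p (p.2 p.1)].
Proof.
move=> Qconv Qclosed Qge Qex.
pose h p := ereal_inf [set r%:E | r in Q p].
have h_ge p : ((p.2 p.1)%:E <= h p)%E.
  by apply: le_ereal_inf_tmp => _ [r Qr <-]; rewrite lee_fin; exact: Qge.
have h_le p r : Q p r -> (h p <= r%:E)%E.
  by move=> Qr; apply: ereal_inf_lbound; exists r.
have h_lt p r : (h p < r%:E)%E -> exists2 rho, Q p rho & rho < r.
  by move=> /ereal_inf_lt[_ [rho Qr <-]]; rewrite lte_fin; exists rho.
have hNy p : (-oo < h p)%E by rewrite (lt_le_trans _ (h_ge p))// ltNyr.
have near_refl p e : 0 < e -> pair_near p p e.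
  move=> e0; split; first by rewrite subrr normr0.
  rewrite (_ : (fun y => _) = fun=> 0) ?dnorm_cst0//.
  by apply/funext => y; rewrite subrr.
exists h; split; [|split; [|split; [|split; [|split]]]] => //.
- move=> p q t dp dq t0 t1 /=.
  have [hp|hp] := eqVneq (h p) +oo%E.
    rewrite hp gt0_muley ?lte_fin// addye ?leey// gt_eqF//.
    have := hNy q; case: (h q) => [x _| _|//]; first by rewrite -EFinM ltNyr.
    by rewrite gt0_muley ?lte_fin ?subr_gt0// ltNyr.
  have [hq|hq] := eqVneq (h q) +oo%E.
    rewrite hq [((1 - t)%:E * _)%E]gt0_muley ?lte_fin ?subr_gt0// addey ?leey// gt_eqF//.
    by have := hNy p; move: hp; case: (h p) => // x _ _; rewrite -EFinM ltNyr.
  move: (hNy p) (hNy q) (@h_lt p) (@h_lt q) hp hq.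
  case: (h p) => // a _; case: (h q) => // b _ hlp hlq _ _.
  rewrite -!EFinM -EFinD; apply/lee_addgt0Pr => e e0.
  have [|r1 Q1 r1a] := hlp (a + e); first by rewrite lte_fin ltrDl.
  have [|r2 Q2 r2b] := hlq (b + e); first by rewrite lte_fin ltrDl.
  have t01 : 0 < t < 1 by rewrite t0.
  apply: le_trans (h_le _ _ (Qconv _ _ _ _ _ Q1 Q2 t01)) _.
  rewrite -EFinD lee_fin.
  have h1 : t * r1 <= t * (a + e) by rewrite ler_wpM2l// ltW.
  have h2 : (1 - t) * r2 <= (1 - t) * (b + e) by rewrite ler_wpM2l ?subr_ge0// ltW.
  lra.
- have [p [r [dp Qr]]] := Qex; exists p; split=> //.
  by rewrite (le_lt_trans (h_le _ _ Qr))// ltry.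
- move=> p dp r rh; apply: contrapT => ne.
  have : Q p r.
    apply: Qclosed => // e e0; apply: contrapT => nq; apply: ne.
    exists e; split=> // q dq q1 q2; rewrite ltNge; apply/negP => hr.
    have /h_lt[rho Qrho rho_lt] : (h q < (r + e)%:E)%E.
      by rewrite (le_lt_trans hr)// lte_fin ltrDl.
    by apply: nq; exists q, rho; split=> //; exact: ltW.
  by move=> /h_le; rewrite leNgt rh.
- apply/seteqP; split=> p /= [dp]; last move=> hp; last first.
    split=> //; apply: Qclosed => // e e0.
    have /h_lt[rho Qrho rho_lt] : (h p < (p.2 p.1 + e)%:E)%E.
      by rewrite hp lte_fin ltrDl.
    by exists p, rho; split=> //; [exact: near_refl|exact: ltW].
  move=> Qp; split=> //; apply/eqP; rewrite eq_le h_ge andbT; exact: h_le.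
Qed.

(** A proper function is still required: it is 1 at the origin and +oo elsewhere, hence strictly
    above the duality product. *)
Lemma representable_set0 : representable (set0 : op Y).
Proof.
pose Q (p : Y * (Y -> R)) (r : R) := [/\ p.1 = 0, p.2 = (fun=> 0) & 1 <= r].
have -> : set0 = [set p : Y * (Y -> R) | is_dual p.2 /\ Q p (p.2 p.1)].
  apply/seteqP; split=> // p [dp [_ p2]]; rewrite p2 => /(lt_le_trans ltr01).
  by rewrite ltxx.
apply: representable_epigraph.
- move=> p q a b t [p1 p2 a1] [q1 q2 b1] /andP[t0 t1]; split=> /=.
  + by rewrite p1 q1 !scaler0 addr0.
  + by rewrite p2 q2; apply/funext => y; rewrite !mulr0 addr0.
  + have : t * 1 <= t * a by rewrite ler_wpM2l// ltW.
    have : (1 - t) * 1 <= (1 - t) * b by rewrite ler_wpM2l// subr_ge0 ltW.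
    lra.
- move=> p r dp H; split.
  + apply/eqP; rewrite -normr_le0; apply/ler_addgt0Pr => e e0; rewrite add0r.
    have [q [rho [_ [q1 _] _ [q0 _ _]]]] := H e e0.
    by move: q1; rewrite q0 sub0r normrN => /ltW.
  + have n0 : dnorm p.2 <= 0.
      apply/ler_addgt0Pr => e e0; rewrite add0r.
      have [q [rho [_ [_ q1] _ [_ q0 _]]]] := H e e0.
      move: q1; rewrite dnormBC q0 => /ltW; congr (dnorm _ <= _).
      by apply/funext => y; rewrite subr0.
    apply/funext => y; apply/eqP; rewrite -normr_le0.
    have := ler_dnorm y dp.
    have : dnorm p.2 * `|y| <= 0 * `|y| by rewrite ler_wpM2r.
    by rewrite mul0r => h1 h2; exact: le_trans h2 h1.
  + apply/ler_addgt0Pr => e e0.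
    by have [q [rho [_ _ h1 [_ _ h2]]]] := H e e0; exact: le_trans h2 h1.
- by move=> p r [_ -> r1]; rewrite (le_trans _ r1).
- by exists (0, fun=> 0), 1; split=> //; exact: is_dual_cst0.
Qed.

End Representability.

(** * Intersections of lower limits of operators with the Minty property *)

Section LowerLimit.
Variables (R : realType) (Y : normedModType R) (I : Type) (S : I -> nat -> op Y).
Hypothesis Sg : forall i n, in_graph_space (S i n).
Hypothesis Sm : forall i n, monotone_op (S i n).
Hypothesis Sminty : forall i n x0 g0 s, 0 < s -> is_dual g0 ->
  exists q, [/\ S i n q, q.2 (q.1 - x0) - g0 (q.1 - x0) <= 73 * s ^+ 2 &
    - s ^+ 2 <= q.2 (q.1 - x0) - g0 (q.1 - x0) ->
    `|q.1 - x0| <= 27 * s /\ dnorm (fun v => q.2 v - g0 v) <= 27 * s].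

(* Epigraph of the epi-upper limit of the Fitzpatrick functions of the [S i n]. *)
Let Qi i (p : Y * (Y -> R)) (r : R) := forall e, 0 < e ->
  exists N, forall n, (N <= n)%N -> exists p', [/\ is_dual p'.2, pair_near p p' e &
    fitz_epi (S i n) p'.1 p'.2 (r + e)].

Let Q p r := is_dual p.2 /\ forall i, Qi i p r.

Let Q_conv p q a b t : Q p a -> Q q b -> 0 < t < 1 ->
  Q (pair_conv t p q) (t * a + (1 - t) * b).
Proof.
move=> [dp Qp] [dq Qq] t01; split; first exact: is_dual_conv.
move=> i e e0; have [N1 H1] := Qp i e e0; have [N2 H2] := Qq i e e0.
exists (maxn N1 N2) => n; rewrite geq_max => /andP[n1 n2].
have [p' [dp' np' Ep']] := H1 n n1; have [q' [dq' nq' Eq']] := H2 n n2.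
exists (pair_conv t p' q'); split; first exact: is_dual_conv.
  exact: pair_near_conv.
have := fitz_epi_conv (@Sg i n) t01 Ep' Eq'.
by have -> : t * (a + e) + (1 - t) * (b + e) = t * a + (1 - t) * b + e by ring.
Qed.

Let Q_closed p r : is_dual p.2 -> (forall e, 0 < e -> exists q rho,
  [/\ is_dual q.2, pair_near p q e, rho <= r + e & Q q rho]) -> Q p r.
Proof.
move=> dp H; split=> // i e e0; have e2 : 0 < e / 2 by rewrite divr_gt0.
have [q [rho [dq pq rr [_ Qq]]]] := H _ e2; have [N HN] := Qq i _ e2.
exists N => n /HN[p' [dp' qp' [_ E]]]; exists p'; split=> //.
  by rewrite [e]splitr; exact: pair_near_trans qp'.
by split=> // q' Sq'; have := E q' Sq'; lra.
Qed.

(** At the point [q] given by [Sminty] the Fitzpatrick supremum is at least [g x - 73 * s ^+ 2];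
    then [s] tends to 0. *)
Let fitz_ge i n x g r : fitz_epi (S i n) x g r -> g x <= r.
Proof.
move=> [dg H]; apply/ler_addgt0Pr => e e0.
have [s [s0 s1 se s73]] := small_radius e0 (ler0n R 73).
have [q [Sq le _]] := Sminty i n x s0 dg.
have dq := Sg Sq; have := H q Sq; move: le.
rewrite (dualB _ _ dq) (dualB _ _ dg).
have : s ^+ 2 <= s by rewrite expr2 ler_piMr// ltW.
lra.
Qed.

Let Q_ge (i0 : I) p r : Q p r -> p.2 p.1 <= r.
Proof.
move=> [dp Qp]; apply/ler_addgt0Pr => e e0; have e2 : 0 < e / 2 by rewrite divr_gt0.
have K0 : 0 <= `|p.1| + dnorm p.2 + 1 by rewrite !addr_ge0// dnorm_nneg.
have [d [d0 d1 de dK]] := small_radius e2 K0.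
have [N /(_ N (leqnn _))[p' [dp' pp' E]]] := Qp i0 d d0.
have := pairing_near_le dp dp' d1 pp'; rewrite ler_norml => /andP[h _].
by have := fitz_ge E; lra.
Qed.

Let liminf_Q i p : liminf_op (S i) p -> Qi i p (p.2 p.1).
Proof.
move=> [dp [u [Su up]]] e e0.
have K0 : 0 <= `|p.1| + dnorm p.2 + 1 by rewrite !addr_ge0// dnorm_nneg.
have [d [d0 d1 de dK]] := small_radius e0 K0.
have [N HN] := up d d0; exists N => n Nn.
have [u1 u2] := HN n Nn.
have du := Sg (Su n).
exists (u n); split=> //; first by split; lra.
have := pairing_near_le dp du d1 (conj u1 u2); rewrite ler_norml => /andP[_ h].
have [_ E] := monotone_fitz_epi (@Sg i n) (@Sm i n) (Su n).
by split=> // q Sq; have := E q Sq; lra.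
Qed.

Let Q_near i p : is_dual p.2 -> Qi i p (p.2 p.1) -> forall e, 0 < e ->
  exists N, forall n, (N <= n)%N -> exists2 q, S i n q & pair_near p q e.
Proof.
(* With 56, the distance [27 * s] is less than [e / 2]. The extra 1 in [K0] pays for the slack [d]
   in the epigraph, besides the variation of the duality product. *)
move=> dp Qp e e0; pose s := e / 56.
have s0 : 0 < s by rewrite divr_gt0.
have K0 : 0 <= `|p.1| + dnorm p.2 + 1 + 1 by rewrite !addr_ge0// dnorm_nneg.
have m0 : 0 < Num.min (s ^+ 2) (e / 2).
  by rewrite lt_min exprn_gt0//= divr_gt0.
have [d [d0 d1]] := small_radius m0 K0.
rewrite !le_min => /andP[_ de] /andP[dK _].
have [N HN] := Qp d d0; exists N => n /HN[p' [dp' pp' [_ E]]].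
have := pairing_near_le dp dp' d1 pp'; rewrite ler_norml => /andP[h _].
have [q [Sq _ H]] := Sminty i n p'.1 s0 dp'; have dq := Sg Sq.
have [|q1 q2] := H.
  by have := E q Sq; rewrite (dualB _ _ dq) (dualB _ _ dp'); lra.
exists q => //; rewrite [e]splitr.
have p'q : pair_near p' q (e / 2) by split; rewrite /s in q1 q2; lra.
have pp'2 : pair_near p p' (e / 2) by case: pp' => ? ?; split; lra.
exact: pair_near_trans p'q.
Qed.

Let Q_liminf i p : is_dual p.2 -> Qi i p (p.2 p.1) -> liminf_op (S i) p.
Proof.
move=> dp Qp; split=> //.
(* [Q_near] picks points depending on [e]; points within [n.+1%:R^-1] of the least distance to [p]
   give one sequence for all [e]. *)
pose dist (q : Y * (Y -> R)) := Num.max `|q.1 - p.1| (dnorm (fun y => q.2 y - p.2 y)).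
have dist_inf n : has_inf [set dist q | q in S i n].
  split; last by exists 0 => _ [q _ <-]; rewrite le_max normr_ge0.
  by have [q [Sq _ _]] := Sminty i n p.1 ltr01 dp; exists (dist q), q.
have choose n : {q | S i n q /\ dist q < inf [set dist q | q in S i n] + n.+1%:R^-1}.
  apply: cid; have n0 : 0 < n.+1%:R^-1 :> R by rewrite invr_gt0.
  by have [_ [q Sq <-] qlt] := inf_adherent n0 (dist_inf n); exists q.
exists (fun n => sval (choose n)); split=> [n|e e0]; first by case: (choose n) => q [].
have e2 : 0 < e / 2 by rewrite divr_gt0.
have [N1 H1] := Q_near dp Qp e2.
have [N2 _ H2] := near_infty_natSinv_lt (PosNum e2).
exists (maxn N1 N2) => n; rewrite geq_max => /andP[n1 n2].
have := H2 n n2; rewrite /= => hn.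
case: (choose n) => q [Sq qlt] /=.
have [q' Sq' [q1 q2]] := H1 n n1.
have : inf [set dist q | q in S i n] <= dist q'.
  by apply: ge_inf; [case: (dist_inf n)|exists q'].
have : dist q' < e / 2 by rewrite gt_max q1 q2.
move=> h1 h2.
have : dist q < e.
  apply: lt_trans qlt _; rewrite [e]splitr; apply: ler_ltD => //.
  exact/ltW/(le_lt_trans h2).
by rewrite gt_max => /andP[].
Qed.

Lemma representable_cap_liminf (i0 : I) :
  representable [set p | forall i, liminf_op (S i) p].
Proof.
have SE : [set p | forall i, liminf_op (S i) p] =
    [set p | is_dual p.2 /\ Q p (p.2 p.1)].
  apply/seteqP; split=> [p H|p [dp [_ Qp]] i]; last exact: Q_liminf.
  have dp : is_dual p.2 by case: (H i0).
  by split=> //; split=> // i; exact: liminf_Q.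
(* An empty [Q] yields no proper function, so this case goes through the empty operator. *)
have [[p [r Qp]]|nQ] := pselect (exists p r, Q p r).
  rewrite SE; apply: representable_epigraph.
  - exact: Q_conv.
  - exact: Q_closed.
  - exact: Q_ge i0.
  - by exists p, r; split=> //; case: Qp.
have -> : [set p | forall i, liminf_op (S i) p] = set0.
  by rewrite SE; apply/seteqP; split=> // p [dp Qp]; apply: nQ; exists p, (p.2 p.1).
exact: representable_set0.
Qed.

End LowerLimit.

Theorem theorem4p4 (R : realType) (X Y : completeNormedModType R)
  (T : op X) (A : {linear Y -> X}) :
  maximal_monotone T -> typeD T -> continuous A ->
  representable (var_comp A T).
Proof.
move=> [Tg [Tm _]] TD Ac; have TN := typeD_typeNI Tg TD.
pose vanishing (lam : nat -> R) := (forall n, 0 < lam n) /\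
  forall e : R, 0 < e -> exists N, forall n, (N <= n)%N -> lam n < e.
(* An explicit null sequence shows that the family indexed by such sequences is inhabited. *)
have vanishing_inv : vanishing (fun n => n.+1%:R^-1).
  split=> [n|e e0]; first by rewrite invr_gt0.
  by have [N _ HN] := near_infty_natSinv_lt (PosNum e0); exists N => n /HN.
pose S (i : {lam | vanishing lam}) n := compose_op A (yosida T (sval i n)).
have -> : var_comp A T = [set p | forall i, liminf_op (S i) p].
  apply/seteqP; split=> p H; first by move=> [lam [l0 l1]]; exact: H.
  by move=> lam l0 l1; exact: (H (exist _ lam (conj l0 l1))).
apply: representable_cap_liminf (exist _ _ vanishing_inv).
- by move=> i n; exact: compose_yosida_in_graph.
- by move=> [lam [l0 l1]] n; exact: compose_yosida_monotone.
- by move=> [lam [l0 l1]] n x0 g0 s; exact: compose_yosida_minty.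
Qed.
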